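(* Let $\Gamma$ be an infinite connected subgraph of $\mathbb B$ with natural weights. There exist constants $c_0,c_1,c_2>0$ such that the following holds. Suppose $x_0\in\Gamma$, $r\ge1$, $\lambda\ge1$, $B=B(x_0,r)$ is $\lambda$-good, and let $I=I(\lambda,r)=[r^3\lambda^{-6},r^3\lambda^{-5}]$. Then: (a) for $x\in B(x_0,r/\lambda)$, $\;c_0\dfrac{r^3}{\lambda^5}\le E^x\tau_B\le2\lambda r^3$; (b) for each $K\ge0$, $\;q_{2t}(x_0,y)\le(1+\sqrt K)t^{-2/3}\lambda^3$ for all $t\in I$ and $y\in B(x_0,Kt^{1/3})$; (c) for $x\in B(x_0,r/\lambda)$, $\;q_{2t}(x,y)\ge c_1t^{-2/3}\lambda^{-17}$ whenever $d(x,y)\le c_2\lambda^{-19}r$ and $t\in I$.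
   Context: $\mathbb B$ is the rooted tree in which every vertex has $n_0\ge2$ children. On $\Gamma$: $\mu_{xy}=1$ for adjacent $x,y$ and $0$ otherwise, $\mu_x$ the degree of $x$ in $\Gamma$, $\mu(A)=\sum_{x\in A}\mu_x$, $d$ the graph distance in $\Gamma$, $B(x,r)=\{y\in\Gamma:d(x,y)\le r\}$, $V(x,r)=\mu(B(x,r))$. $Y$ is the continuous-time simple random walk on $\Gamma$ (exponential mean-1 holding times, jumps to a uniform neighbour) with law $P^x$ and expectation $E^x$, $q_t(x,y)=P^x(Y_t=y)/\mu_y$, $\tau_B=\inf\{t\ge0:Y_t\notin B\}$. $M(x,r)$ is the smallest $m$ such that there is $A=\{z_1,\dots,z_m\}\subset\Gamma$ with $d(x,z_i)\in[r/4,3r/4]$ for all $i$ such that every path in $\Gamma$ from $x$ to $\Gamma\setminus B(x,r)$ passes through $A$. The ball $B(x,r)$ is $\lambda$-good if: $x\in\Gamma$; $r^2\lambda^{-2}\le V(x,r)\le r^2\lambda$; $M(x,r)\le\lambda/64$; $V(x,r/\lambda)\ge r^2\lambda^{-4}$; $V(x,r/\lambda^2)\ge r^2\lambda^{-6}$. *)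

(* Defs.v *)
From HB Require Import structures.
From mathcomp Require Import all_boot all_order all_algebra.
From mathcomp Require Import all_classical all_reals all_analysis.

Set Implicit Arguments.
Unset Strict Implicit.
Unset Printing Implicit Defensive.
Import Order.TTheory GRing.Theory Num.Theory.
Import numFieldNormedType.Exports.
Local Open Scope classical_set_scope.
Local Open Scope ring_scope.

(* A vertex of B is a finite word over 'I_n0; the root is [::]; the i-th
   child of w is i :: w, and the parent of i :: w is w. *)
Definition word (n0 : nat) := seq 'I_n0.

Definition tadj (n0 : nat) (u v : word n0) : bool :=
  ((u != [::]) && (behead u == v)) || ((v != [::]) && (behead v == u)).

Definition nbrsB (n0 : nat) (w : word n0) : seq (word n0) :=
  (if w is _ :: p then [:: p] else [::]) ++ [seq i :: w | i <- enum 'I_n0].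

Definition subgraph_of_B (n0 : nat) (V : pred (word n0)) (E : rel (word n0)) :=
  (forall x y, E x y -> [&& V x, V y & tadj x y]) /\ (forall x y, E x y = E y x).

Definition connected_graph (n0 : nat) (V : pred (word n0)) (E : rel (word n0)) :=
  forall x y, V x -> V y -> exists p : seq (word n0), path E x p /\ last x p = y.

Definition infinite_graph (n0 : nat) (V : pred (word n0)) :=
  ~ finite_set [set x | V x].

Section Graph.
Variables (R : realType) (n0 : nat) (V : pred (word n0)) (E : rel (word n0)).

Definition nbrs (x : word n0) : seq (word n0) := [seq y <- nbrsB x | E x y].

(* mu_x = degree of x in Gamma (natural weights mu_xy = 1 on edges) *)
Definition mu (x : word n0) : R := (size (nbrs x))%:R.

(* graph distance in Gamma (0 if y is not reachable from x; never used
   in that case since Gamma is connected) *)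
Definition reach_in (x y : word n0) (n : nat) : bool :=
  `[< exists p : seq (word n0), [/\ size p = n, path E x p & last x p = y] >].

Definition gdist (x y : word n0) : nat :=
  match pselect (exists n, reach_in x y n) with
  | left h => ex_minn h
  | right _ => 0%N
  end.

Definition gball (x : word n0) (r : R) : set (word n0) :=
  [set y | V y /\ (gdist x y)%:R <= r].

Definition muset (A : set (word n0)) : R := \sum_(y \in A) mu y.

Definition vol (x : word n0) (r : R) : R := muset (gball x r).

(* A (given as a list s of its elements) is admissible for M(x,r) *)
Definition cut_ok (x : word n0) (r : R) (s : seq (word n0)) : Prop :=
  (forall z, z \in s -> V z /\ r / 4 <= (gdist x z)%:R /\ (gdist x z)%:R <= 3 * r / 4)
  /\ (forall p : seq (word n0), path E x p ->
        V (last x p) -> ~ gball x r (last x p) ->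
        exists2 z, z \in s & z \in x :: p).

Definition cut_size (x : word n0) (r : R) (m : nat) : bool :=
  `[< exists s : seq (word n0), size s = m /\ cut_ok x r s >].

Definition Mcut (x : word n0) (r : R) : \bar R :=
  match pselect (exists m, cut_size x r m) with
  | left h => ((ex_minn h)%:R)%:E
  | right _ => +oo%E
  end.

Definition good (x : word n0) (r lam : R) : Prop :=
  [/\ V x,
      r ^+ 2 / lam ^+ 2 <= vol x r /\ vol x r <= r ^+ 2 * lam,
      (Mcut x r <= (lam / 64)%:E)%E,
      vol x (r / lam) >= r ^+ 2 / lam ^+ 4 &
      vol x (r / lam ^+ 2) >= r ^+ 2 / lam ^+ 6].

(* Discrete skeleton (jump chain): P^x(X_k = y) *)
Fixpoint pk (k : nat) (x y : word n0) : R :=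
  match k with
  | 0%N => (x == y)%:R
  | k'.+1 => \sum_(z <- nbrs x) (pk k' z y) / mu x
  end.

(* P^x(X_0, ..., X_k all in A) *)
Fixpoint pstay (A : set (word n0)) (k : nat) (x : word n0) : R :=
  match k with
  | 0%N => (`[< A x >])%:R
  | k'.+1 => (`[< A x >])%:R * \sum_(z <- nbrs x) (pstay A k' z) / mu x
  end.

Definition poisson (t : R) (k : nat) : R := expR (- t) * t ^+ k / (k`!)%:R.

(* continuous-time walk Y_t = X_{N_t} with N a rate-1 Poisson process:
   P^x(Y_t = y) *)
Definition pY (t : R) (x y : word n0) : R :=
  limn (series (fun k => poisson t k * pk k x y)).

Definition qker (t : R) (x y : word n0) : R := pY t x y / mu y.

(* P^x(tau_A > t) = P^x(Y_s in A for all s in [0,t]) *)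
Definition surv (A : set (word n0)) (t : R) (x : word n0) : R :=
  limn (series (fun k => poisson t k * pstay A k x)).

(* E^x tau_A = int_0^oo P^x(tau_A > t) dt *)
Definition Etau (A : set (word n0)) (x : word n0) : \bar R :=
  (\int[lebesgue_measure]_(t in `[0%R, +oo[%classic) (surv A t x)%:E)%E.

End Graph.

(* Main.v *)
(** Let [E(f, f)] be the Dirichlet energy of [f], the sum of [(f x - f y)^2]
    over the edges.  Cauchy-Schwarz along a path gives
    [(f x - f y)^2 <= d(x, y) E(f, f)], which is applied to two families of
    functions.

    Green function [g_x] of the walk killed on leaving [B]: [E(g_x, g_x) = g_x(x)]
    and [g_x] vanishes outside [B], so [g_x(y)^2 <= d(x, B^c) d(y, B^c)], whence
    the upper bound for [E^x tau_B], the sum of [g_x(y) mu_y] over [B].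
    Conversely the tree structure turns the [m <= lam / 64] cut points at
    distance at least [r / 4] into a function equal to 1 at [x0], vanishing
    outside [B] and of energy at most [4 m / r]; the Dirichlet principle yields
    [g_{x0}(x0) >= 16 r / lam], and the path inequality spreads this bound over
    [B(x0, r / lam)].

    Heat kernel [q_t(x, .)]: since [s |-> q_s(x, x)] is convex and nonnegative,
    the energy of [q_t(x, .)] is at most [q_t(x, x) / t].  Averaging the path
    inequality over [B(x0, r / lam^2)] bounds [q_{2t}(x0, x0)] from above, while
    [E^x tau_B <= n + P^x(tau_B > n) sup_z E^z tau_B] and Cauchy-Schwarz bound
    [q_{2t}(x, x)] from below; the path inequality then handles [q_{2t}(x, y)].
    All constants are absorbed by [lam >= 64], which holds because a cut set is
    nonempty. *)
Require Import Defs.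
From HB Require Import structures.
From mathcomp Require Import all_boot all_order all_algebra.
From mathcomp Require Import all_classical all_reals all_analysis.
From mathcomp Require Import measurable_realfun ring lra.
Set Implicit Arguments.
Unset Strict Implicit.
Unset Printing Implicit Defensive.
Import Order.TTheory GRing.Theory Num.Theory.
Import numFieldNormedType.Exports.
Local Open Scope classical_set_scope.
Local Open Scope ring_scope.

(** * Poisson averages of bounded sequences and their time derivatives *)

Section PoissonAverage.
Variable R : realType.
Implicit Types (a b : nat -> R) (t s M : R).

(** The mean of [a] at a Poisson time of parameter [t]. As [Y] is the jump chain read at a Poisson
    clock, every continuous-time quantity below is [Po] of its discrete counterpart. *)
Definition Po a t : R := limn (series (fun k => poisson t k * a k)).

Lemma poisson_ge0 t k : 0 <= t -> 0 <= poisson t k.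
Proof.
by move=> t0; rewrite /poisson !mulr_ge0// ?expR_ge0 ?exprn_ge0 ?invr_ge0.
Qed.

Lemma poissonS t k : k.+1%:R * poisson t k.+1 = t * poisson t k.
Proof.
rewrite /poisson factS natrM exprS invfM.
by field; rewrite pnatr_eq0 -lt0n fact_gt0 -(natrD _ 1) pnatr_eq0.
Qed.

Lemma is_cvg_pseries_fact a M x : (forall k, `|a k| <= M) ->
  cvgn (pseries (fun k => a k / k`!%:R) x).
Proof.
move=> aM; apply: normed_cvg.
apply: (@series_le_cvg _ _ (M *: exp_coeff `|x|)) => /=.
- by move=> n.
- move=> n; apply: mulr_ge0; first exact: le_trans (aM 0%N).
  exact: exp_coeff_ge0.
- move=> n; rewrite /exp_coeff/= !normrM normfV normrX (@ger0_norm _ n`!%:R)//.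
  rewrite mulrAC -mulrA ler_wpM2r//.
- exact/is_cvg_seriesZ/is_cvg_series_exp_coeff.
Qed.

Lemma Po_seriesE a t : series (fun k => poisson t k * a k) =
  expR (- t) *: pseries (fun k => a k / k`!%:R) t.
Proof.
rewrite /pseries -seriesZ; congr series; apply/funext => k.
rewrite /poisson /=; have -> : forall (c : R) (f : nat -> R) j, (c *: f) j = c * f j by [].
by ring.
Qed.

Lemma is_cvg_Po a M t : (forall k, `|a k| <= M) ->
  cvgn (series (fun k => poisson t k * a k)).
Proof.
move=> aM; rewrite Po_seriesE; apply: is_cvgZl_tmp.
exact: is_cvg_pseries_fact aM.
Qed.

Lemma PoE a M t : (forall k, `|a k| <= M) ->
  Po a t = expR (- t) * limn (pseries (fun k => a k / k`!%:R) t).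
Proof.
move=> aM; rewrite /Po Po_seriesE limZl_tmp//.
exact: is_cvg_pseries_fact aM.
Qed.

Lemma cvg_Po a M t : (forall k, `|a k| <= M) ->
  series (fun k => poisson t k * a k) @ \oo --> Po a t.
Proof. by move=> aM; exact: is_cvg_Po aM. Qed.

Lemma Po1 t : Po (fun=> 1) t = 1.
Proof.
rewrite (@PoE _ 1); last by move=> k; rewrite normr1.
rewrite (_ : pseries _ t = series (exp_coeff t)); last first.
  by congr series; apply/funext => k; rewrite /exp_coeff/= mul1r mulrC.
by rewrite -[limn _]/(expR t) -expRD addNr expR0.
Qed.

Lemma Po_ge0 a M t : 0 <= t -> (forall k, `|a k| <= M) -> (forall k, 0 <= a k) ->
  0 <= Po a t.
Proof.
move=> t0 aM a0; apply: limr_ge; first exact: is_cvg_Po aM.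
by near=> n; apply: sumr_ge0 => k _; rewrite mulr_ge0// poisson_ge0.
Unshelve. all: by end_near. Qed.

Lemma poisson_sum_le1 t n : 0 <= t -> series (poisson t) n <= 1.
Proof.
move=> t0; rewrite -(Po1 t) /Po.
have -> : series (poisson t) = series (fun k => poisson t k * 1).
  by congr series; apply/funext => k; rewrite mulr1.
apply: nondecreasing_cvgn_le; last first.
  by apply: (@is_cvg_Po _ 1) => k; rewrite normr1.
apply/nondecreasing_series => k _ _.
by rewrite mulr1 poisson_ge0.
Qed.

Lemma cvg_poisson_sum t : series (poisson t) @ \oo --> (1 : R).
Proof.
have := @cvg_Po (fun=> 1) 1 t (fun _ => eq_ind_r (fun x => x <= 1) (lexx _) (normr1 _)).
rewrite Po1 (_ : (fun k => poisson t k * 1) = poisson t)//.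
by apply/funext => k; rewrite mulr1.
Qed.

Lemma norm_shift_diff a M : (forall k, `|a k| <= M) ->
  forall k, `|a k.+1 - a k| <= M + M.
Proof. by move=> aM k; apply: (le_trans (ler_normB _ _)); apply: lerD. Qed.

(** With [exp (- t)] factored out the average is a power series, whose term-by-term derivative
    shifts [a]; the exponential contributes the term [- a k]. *)
Lemma is_derive_Po a M t : (forall k, `|a k| <= M) ->
  is_derive t (1 : R) (Po a) (Po (fun k => a k.+1 - a k) t).
Proof.
move=> aM; pose c k := a k / k`!%:R.
have dE : forall b, pseries_diffs (fun k => b k / k`!%:R) = (fun k => b k.+1 / k`!%:R).
  move=> b; apply/funext => k; rewrite /pseries_diffs factS natrM.
  by field; rewrite pnatr_eq0 -lt0n fact_gt0 -(natrD _ 1) pnatr_eq0.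
have -> : Po a = (fun s => expR (- s)) * (fun s => limn (pseries c s)).
  by apply/funext => s; rewrite (PoE _ aM).
have aM1 : forall k, `|a k.+1| <= M by move=> k; exact: aM.
have aM2 : forall k, `|a k.+2| <= M by move=> k; exact: aM.
have D : is_derive t 1 (fun s => limn (pseries c s))
    (limn (pseries (fun k => a k.+1 / k`!%:R) t)).
  rewrite -dE; apply: (@pseries_snd_diffs _ _ (`|t| + 1)).
  - exact: is_cvg_pseries_fact aM.
  - by rewrite dE; exact: is_cvg_pseries_fact aM1.
  - by rewrite !dE; exact: is_cvg_pseries_fact aM2.
  - by rewrite (@ger0_norm _ (_ + 1)) ?addr_ge0// ltrDl.
apply: is_derive_eq.
rewrite (PoE _ (norm_shift_diff aM)).
have -> : pseries (fun k => (a k.+1 - a k) / k`!%:R) t =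
   pseries (fun k => a k.+1 / k`!%:R) t - pseries c t.
  rewrite /pseries -seriesN -seriesD; congr series; apply/funext => k.
  have -> : forall f g : nat -> R, (f + - g) k = f k - g k by [].
  by rewrite /c /=; ring.
rewrite limB; [|exact: is_cvg_pseries_fact aM1|exact: is_cvg_pseries_fact aM].
rewrite /GRing.scale/=; ring.
Qed.

(** Binomial expansion of [(t + t) ^ k]: two independent Poisson variables of parameter [t] add up
    to one of parameter [t + t]. *)
Lemma poissonD t k : poisson (t + t) k = \sum_(i < k.+1) poisson t (k - i) * poisson t i.
Proof.
rewrite /poisson opprD expRD exprDn !mulr_sumr mulr_suml; apply: eq_bigr => i _.
rewrite -mulr_natr.
have ik : (i <= k)%N by rewrite -ltnS.
have /(congr1 (fun n => n%:R : R)) := bin_fact ik.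
rewrite !natrM => <-.
by field; rewrite !pnatr_eq0 -!lt0n !fact_gt0 bin_gt0 ik.
Qed.

Lemma sum_triangle (F : nat -> nat -> R) N :
  \sum_(k < N) \sum_(i < k.+1) F (k - i)%N i =
  \sum_(j < N) \sum_(i < N) (if (i + j < N)%N then F j i else 0).
Proof.
pose G k i := if (i <= k)%N then F (k - i)%N i else 0.
transitivity (\sum_(i < N) \sum_(k < N) G k i).
  rewrite exchange_big/=; apply: eq_bigr => k _.
  rewrite -(big_mkord xpredT (fun i => F (k - i)%N i)).
  rewrite -(big_mkord xpredT (fun i => G k i)).
  rewrite (@big_cat_nat _ _ _ k.+1 0 N)//= [X in _ + X]big_nat [X in _ + X]big1 ?addr0.
    by apply: eq_big_nat => i /andP[_ ik]; rewrite /G -ltnS ik.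
  by move=> i /andP[ki _]; rewrite /G leqNgt ki.
rewrite [RHS]exchange_big/=; apply: eq_bigr => i _.
rewrite -(big_mkord xpredT (fun k => G k i)).
rewrite -(big_mkord xpredT (fun j => if (i + j < N)%N then F j i else 0)).
have iN : (i <= N)%N by exact: ltnW.
rewrite (@big_cat_nat _ _ _ i 0 N)//= big_nat big1 ?add0r; last first.
  by move=> k /andP[_ ki]; rewrite /G leqNgt ki.
rewrite (@big_cat_nat _ _ _ (N - i) 0 N _ (fun j => if _ then _ else _))//= ?leq_subr//.
rewrite [X in _ = _ + X]big_nat [X in _ = _ + X]big1 ?addr0; last first.
  by move=> j /andP[jN _]; rewrite ltnNge -leq_subLR jN.
rewrite -{1}(add0n (i : nat)) big_addn; apply: eq_big_nat => j /andP[_ jN].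
by rewrite /G leq_addl addnK -ltn_subRL jN.
Qed.

(** The left side sums over squares, the partial sums of [Po a (t + t)] over triangles [i + j < N].
    The two differ by at most [M] times the same difference for the constant sequence 1, which tends
    to [1 * 1 - 1 = 0]. *)
Lemma cvg_Po_double a M t : 0 <= t -> (forall k, `|a k| <= M) ->
  (fun N => \sum_(j < N) \sum_(i < N) poisson t j * poisson t i * a (j + i)%N) @ \oo
   --> Po a (t + t).
Proof.
move=> t0 aM.
pose D b N := \sum_(j < N) \sum_(i < N) poisson t j * poisson t i * b (j + i)%N.
pose T b N := series (fun k => poisson (t + t) k * b k) N.
have TE b N : T b N = \sum_(j < N) \sum_(i < N)
   (if (i + j < N)%N then poisson t j * poisson t i * b (j + i)%N else 0).
  rewrite -(@sum_triangle (fun j i => poisson t j * poisson t i * b (j + i)%N)).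
  rewrite /T /series/= big_mkord; apply: eq_bigr => k _.
  rewrite poissonD mulr_suml; apply: eq_bigr => i _.
  by rewrite subnK// -ltnS.
have DT b N : D b N - T b N = \sum_(j < N) \sum_(i < N)
   (if (i + j < N)%N then 0 else poisson t j * poisson t i * b (j + i)%N).
  rewrite TE -sumrB; apply: eq_bigr => j _; rewrite -sumrB; apply: eq_bigr => i _.
  by case: ifP; rewrite ?subrr ?subr0.
pose c1 : nat -> R := fun=> 1.
have pp j i : 0 <= poisson t j * poisson t i by apply: mulr_ge0; exact: poisson_ge0.
have bd N : `|D a N - T a N| <= M * (D c1 N - T c1 N).
  rewrite !DT mulr_sumr; apply: (le_trans (ler_norm_sum _ _ _)); apply: ler_sum => j _.
  rewrite mulr_sumr; apply: (le_trans (ler_norm_sum _ _ _)); apply: ler_sum => i _.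
  case: ifP => _; first by rewrite normr0 mulr0.
  rewrite /c1 mulr1 normrM mulrC (ger0_norm (pp j i)).
  exact: ler_wpM2r.
have DTc : (fun N => M * (D c1 N - T c1 N)) @ \oo --> (0 : R).
  rewrite -(mulr0 M) -(subrr (1 : R)); apply: cvgM; first exact: cvg_cst.
  apply: cvgB.
    rewrite -[X in _ --> X](mulr1 1).
    rewrite (_ : D c1 = fun N => series (poisson t) N * series (poisson t) N).
      by apply: cvgM; exact: cvg_poisson_sum.
    apply/funext => N; rewrite /D /series/= !big_mkord big_distrl/=.
    apply: eq_bigr => j _; rewrite big_distrr/=; apply: eq_bigr => i _.
    by rewrite /c1 mulr1.
  by rewrite -(Po1 (t + t)); apply: (@cvg_Po _ 1) => k; rewrite normr1.
have D0 : (fun N => D a N - T a N) @ \oo --> (0 : R).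
  apply/norm_cvg0P; apply: (@squeeze_cvgr _ _ _ _ (cst 0) _ _ _ 0 _ DTc).
    by apply: nearW => N; rewrite /= normr_ge0 bd.
  exact: cvg_cst.
have -> : (fun N => \sum_(j < N) \sum_(i < N) poisson t j * poisson t i * a (j + i)%N)
   = (fun N => D a N - T a N) \+ T a.
  by apply/funext => N /=; rewrite subrK.
rewrite -(add0r (Po a _)); apply: cvgD D0 _.
exact: (@cvg_Po _ M).
Qed.

(* The last two hypotheses, which say that [Po a] is nonnegative and convex on
   the half-line, hold when [a (j + i) = <h_j, h_i>] for some vectors [h_j]. *)
Lemma Po_convex_slope a M t : 0 < t -> (forall k, `|a k| <= M) ->
  (forall s, 0 <= s -> 0 <= Po a s) ->
  (forall s, 0 <= s -> 0 <= Po (fun k => a k.+2 - a k.+1 - (a k.+1 - a k)) s) ->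
  t * Po (fun k => a k - a k.+1) (t + t) <= Po a t.
Proof.
move=> t0 aM a0 dda0.
have aMd := norm_shift_diff aM.
have d1 := fun s => is_derive_Po s aM.
have d2 := fun s => is_derive_Po s aMd.
have cont (f df : R -> R) : (forall s : R, is_derive s (1 : R) f (df s)) ->
    forall A, {within A, continuous f}.
  move=> fd A; apply: continuous_subspaceT => s.
  by apply/differentiable_continuous/derivable1_diffP; have [] := fd s.
have tt : t < t + t by rewrite ltrDl.
(* The mean slope on [[t, t + t]] is the derivative at some [c]; a second mean value, on
   [[c, t + t]], shows that the derivative at [t + t] is no smaller. *)
have [c cI E1] := MVT tt (fun s _ => d1 s) (cont _ _ d1 `[t, t + t]%classic).
have {cI} [tc ct2] : t < c /\ c < t + t by move: cI; rewrite in_itv/= => /andP.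
have [c' c'I E2] := MVT ct2 (fun s _ => d2 s) (cont _ _ d2 `[c, t + t]%classic).
have {c'I} cc' : c < c' by move: c'I; rewrite in_itv/= => /andP[].
have NE : Po (fun k => a k - a k.+1) (t + t) = - Po (fun k => a k.+1 - a k) (t + t).
  rewrite /Po -limN; last exact: is_cvg_Po aMd.
  rewrite -seriesN; congr (limn (series _)); apply/funext => k.
  by have -> : forall f : nat -> R, (- f) k = - f k by []; rewrite -mulrN opprB.
have mono : Po (fun k => a k.+1 - a k) c <= Po (fun k => a k.+1 - a k) (t + t).
  rewrite -subr_ge0 E2 mulr_ge0// ?subr_ge0 ?(ltW ct2)//.
  by apply: dda0; rewrite ltW// (lt_trans t0)// (lt_trans tc).
have p2 : 0 <= Po a (t + t) by apply: a0; rewrite addr_ge0 ?ltW.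
rewrite NE mulrN -lerN2 opprK.
have -> : - Po a t = t * Po (fun k => a k.+1 - a k) c - Po a (t + t).
  by move: E1; rewrite addrK => E1; rewrite mulrC -E1; lra.
by rewrite (@le_trans _ _ (t * Po (fun k => a k.+1 - a k) c))// ?gerBl// ler_wpM2l// ltW.
Qed.

End PoissonAverage.

(** * Integrals of Poisson averages over all times *)

Section PoissonIntegral.
Variable R : realType.
Implicit Types (a : nat -> R) (t : R).

Lemma Po_finite_support a n t : (forall k, (n <= k)%N -> a k = 0) ->
  Po a t = \sum_(k < n) poisson t k * a k.
Proof.
move=> an; apply: cvg_lim => //; rewrite -(cvg_shiftn n).
rewrite (_ : (fun _ => _) = cst (\sum_(k < n) poisson t k * a k)); first exact: cvg_cst.
apply/funext => m /=; rewrite /series/= (@big_cat_nat _ _ _ n)//= ?leq_addl//.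
rewrite big_mkord [X in _ + X]big_nat [X in _ + X]big1 ?addr0// => i /andP[ni _].
by rewrite an// mulr0.
Qed.

Lemma poisson_le1 t k : 0 <= t -> poisson t k <= 1.
Proof.
move=> t0; apply: le_trans (poisson_sum_le1 k.+1 t0).
rewrite /series/= big_nat_recr//= lerDr sumr_ge0// => i _; exact: poisson_ge0.
Qed.

(** The weight equals [(k + 1) / t] times the next weight, which is at most 1. *)
Lemma cvgy_poisson k : poisson t k @[t --> +oo] --> (0 : R).
Proof.
have h : (k.+1%:R / t) @[t --> +oo] --> (0 : R).
  rewrite -(mulr0 (k.+1%:R)); apply: cvgM; first exact: cvg_cst.
  by apply/gtr0_cvgV0 => //; exact: nbhs_pinfty_gt.
apply: (@squeeze_cvgr _ _ _ _ (cst 0) _ _ _ 0 _ h); last exact: cvg_cst.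
near=> t; have t0 : 0 < t by near: t; exact: nbhs_pinfty_gt.
rewrite /= (poisson_ge0 _ (ltW t0))/= ler_pdivlMr// mulrC -poissonS.
by rewrite -[leRHS]mulr1 ler_wpM2l// poisson_le1// ltW.
Unshelve. all: by end_near. Qed.

Lemma continuous_Po a M : (forall k, `|a k| <= M) -> continuous (Po a).
Proof.
move=> aM t; apply/differentiable_continuous/derivable1_diffP.
by have [] := is_derive_Po t aM.
Qed.

Lemma norm_nat_bool (b : bool) : `|b%:R| <= 1 :> R.
Proof. by case: b; rewrite ?normr1 ?normr0. Qed.

Lemma Po_delta k t : Po (fun j => (j == k)%:R) t = poisson t k.
Proof.
rewrite (@Po_finite_support _ k.+1) => [|j kj]; last by rewrite gtn_eqF.
rewrite big_ord_recr/= eqxx mulr1 big1 ?add0r// => i _.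
by rewrite ltn_eqF ?mulr0.
Qed.

(** An antiderivative is [- Po c] with [c] the indicator of [j <= k]: minus the probability of at
    most [k] jumps by time [t]. It climbs from -1 at time 0 to 0 at infinity. *)
Lemma integral_poisson k :
  (\int[lebesgue_measure]_(t in `[0%R, +oo[) (poisson (t : R) k)%:E = 1)%E.
Proof.
pose c j : R := (j <= k)%:R.
have cE t : Po c t = \sum_(j < k.+1) poisson t j.
  rewrite (@Po_finite_support _ k.+1) => [|j kj]; last by rewrite /c leqNgt kj.
  by apply: eq_bigr => j _; rewrite /c -ltnS ltn_ord mulr1.
have cb j : `|c j| <= 1 by exact: norm_nat_bool.
have d t : is_derive t (1 : R) (- Po c) (poisson t k).
  have D := is_derive_Po t cb.
  apply: is_derive_eq; rewrite -Po_delta /Po -limN; last exact: is_cvg_Po (norm_shift_diff cb).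
  rewrite -seriesN; congr (limn (series _)); apply/funext => j.
  have -> : forall f : nat -> R, (- f) j = - f j by [].
  rewrite -mulrN opprB /c; congr (_ * _).
  by case: ltngtP; rewrite ?subrr ?subr0.
rewrite (@ge0_continuous_FTC2y _ (fun t => poisson t k) (- Po c) 0 0).
- rewrite add0e -EFinN; congr EFin.
  rewrite -[(- Po c) 0]/(- Po c 0) opprK cE big_ord_recl big1 ?addr0.
    by rewrite /poisson oppr0 expR0 expr0 fact0 !mul1r invr1.
  by move=> i _; rewrite /poisson lift0 expr0n mulr0 mul0r.
- by move=> t; exact: poisson_ge0.
- apply: continuous_subspaceT.
  rewrite (_ : (fun t => poisson t k) = Po (fun j => (j == k)%:R)).
    by apply: (@continuous_Po _ 1) => j; exact: norm_nat_bool.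
  by apply/funext => t; rewrite Po_delta.
- rewrite -oppr0; apply: cvgN.
  rewrite (_ : Po c = fun t => \sum_(j < k.+1) poisson t j); last exact/funext.
  rewrite [X in _ --> X](_ : 0 = \sum_(j < k.+1) (0 : R)); last by rewrite big1.
  by apply: cvg_big => [|j _]; [exact: add_continuous|exact: cvgy_poisson].
- by move=> t _; have [] := d t.
- apply: cvg_at_right_filter; apply: cvgN; exact: (@continuous_Po _ 1).
- by move=> t _; rewrite derive1E; have [_ ->] := d t.
Qed.

(** Tonelli exchanges sum and integral, and each Poisson weight integrates to 1. This turns the mean
    exit time of [Y] into the sum of the survival probabilities of the jump chain. *)
Lemma integral_Po a : (forall k, 0 <= a k <= 1) ->
  (\int[lebesgue_measure]_(t in `[0%R, +oo[) (Po a (t : R))%:E = \sum_(k <oo) (a k)%:E)%E.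
Proof.
move=> a01; have a0 k : 0 <= a k by have /andP[] := a01 k.
have ab k : `|a k| <= 1 by rewrite ger0_norm//; have /andP[] := a01 k.
transitivity (\int[lebesgue_measure]_(t in `[0%R, +oo[)
    (\sum_(k <oo) (poisson (t : R) k * a k)%:E))%E.
  apply: eq_integral => t _; rewrite /Po -EFin_lim; last exact: is_cvg_Po ab.
  by congr (limn _); apply/funext => n /=; rewrite /series/= sumEFin.
have mp k : measurable_fun setT (fun t : R => poisson t k).
  apply: continuous_measurable_fun.
  rewrite (_ : (fun t => _) = Po (fun j => (j == k)%:R)).
    by apply: (@continuous_Po _ 1) => j; exact: norm_nat_bool.
  by apply/funext => t; rewrite Po_delta.
rewrite integral_nneseries//=; last 2 first.
- move=> k; apply/measurable_EFinP; apply: measurable_funTS.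
  by apply: measurable_funM; [exact: mp|exact: measurable_cst].
- move=> k t; rewrite in_itv/= andbT => t0; rewrite lee_fin mulr_ge0//.
  exact: poisson_ge0.
apply: eq_eseriesr => k _.
under eq_integral do rewrite EFinM muleC.
rewrite ge0_integralZl//; first by rewrite integral_poisson mule1.
- by apply/measurable_EFinP; apply: measurable_funTS; exact: mp.
- by move=> t; rewrite /= in_itv/= andbT => t0; rewrite lee_fin poisson_ge0.
- by rewrite lee_fin.
Qed.

End PoissonIntegral.

(** * Dirichlet energy on finite vertex sets and the path inequality *)

Section Energy.
Variables (R : realType) (n0 : nat) (V : pred (word n0)) (E : rel (word n0)).
Hypothesis Esub : subgraph_of_B V E.
Implicit Types (x y z : word n0) (f g : word n0 -> R) (S : seq (word n0)).

Lemma E_sym x y : E x y = E y x. Proof. exact: Esub.2. Qed.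

Lemma E_V x y : E x y -> V x /\ V y.
Proof. by move=> /Esub.1/and3P[]. Qed.

Lemma tadj_nbrsB x y : tadj x y -> y \in nbrsB x.
Proof.
rewrite /tadj /nbrsB mem_cat => /orP[/andP[]|/andP[]].
  by case: x => // i x _ /eqP <-; rewrite mem_seq1 eqxx.
case: y => // i y _ /eqP /= ->; apply/orP; right.
by apply/mapP; exists i; rewrite ?mem_enum.
Qed.

Lemma mem_nbrs x y : (y \in nbrs E x) = E x y.
Proof.
rewrite /nbrs mem_filter andb_idr// => /Esub.1/and3P[_ _].
exact: tadj_nbrsB.
Qed.

Lemma uniq_nbrs x : uniq (nbrs E x).
Proof.
apply: filter_uniq; rewrite /nbrsB cat_uniq; apply/and3P; split.
- by case: x.
- apply/hasPn => _ /mapP[i _ ->]; case: x => // j x; rewrite mem_seq1.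
  by apply/eqP => /(congr1 size)/= /eqP; rewrite -[X in _ == X]addn0 -addn2 eqn_add2l.
- by rewrite map_inj_uniq ?enum_uniq// => i j [].
Qed.

Lemma mu_ge0 x : 0 <= mu R E x. Proof. by rewrite /mu ler0n. Qed.

Lemma sum_nbrsE S x (F : word n0 -> R) : uniq S ->
  (forall y, E x y -> F y != 0 -> y \in S) ->
  \sum_(y <- nbrs E x) F y = \sum_(y <- S) (E x y)%:R * F y.
Proof.
move=> uS FS.
transitivity (\sum_(y <- nbrs E x | y \in S) F y).
  rewrite [RHS]big_mkcond/= big_seq [RHS]big_seq; apply: eq_bigr => y.
  rewrite mem_nbrs => xy; case: ifP => // yS; apply/eqP; apply: contraFT yS.
  exact: FS.
transitivity (\sum_(y <- S | E x y) F y); last first.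
  by rewrite big_mkcond/=; apply: eq_bigr => y _; case: (E x y); rewrite ?mul1r ?mul0r.
rewrite -[LHS]big_filter -[RHS]big_filter; apply: perm_big; apply: uniq_perm.
- exact/filter_uniq/uniq_nbrs.
- exact: filter_uniq.
- by move=> y; rewrite mem_filter mem_nbrs mem_filter andbC.
Qed.

(** The factor one half makes up for each edge appearing in both orientations. *)
Definition energy S f g : R :=
  2^-1 * \sum_(x <- S) \sum_(y <- S) (E x y)%:R * ((f x - f y) * (g x - g y)).

(** The unnormalised Laplacian, degree minus adjacency. *)
Definition lap g x : R := mu R E x * g x - \sum_(y <- nbrs E x) g y.

Lemma lapE g x : lap g x = \sum_(y <- nbrs E x) (g x - g y).
Proof.
by rewrite /lap sumrB; congr (_ - _); rewrite big_const_seq count_predT iter_addr_0 /mu mulr_natl.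
Qed.

(** Summation by parts: the two orientations of an edge contribute equally. As [S] contains all
    neighbours of its points where [f] is nonzero, no boundary term is left. *)
Lemma green S f g : uniq S -> (forall x, x \in S -> f x != 0 -> {subset nbrs E x <= S}) ->
  energy S f g = \sum_(x <- S) f x * lap g x.
Proof.
move=> uS fS; rewrite /energy.
pose h x y := (E x y)%:R * (f x * (g x - g y)).
have -> : \sum_(x <- S) \sum_(y <- S) (E x y)%:R * ((f x - f y) * (g x - g y))
    = \sum_(x <- S) \sum_(y <- S) h x y + \sum_(x <- S) \sum_(y <- S) h y x.
  rewrite -big_split; apply: eq_bigr => x _; rewrite -big_split; apply: eq_bigr => y _.
  rewrite /h (E_sym y x) /=; ring.
rewrite [X in _ + X]exchange_big/=.
have -> : forall A : R, 2^-1 * (A + A) = A by move=> A; field.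
apply: eq_big_seq => x xS; have [fx0|fx0] := eqVneq (f x) 0.
  by rewrite fx0 mul0r big1// => y _; rewrite /h fx0 mul0r mulr0.
rewrite lapE mulr_sumr (@sum_nbrsE S x (fun y => f x * (g x - g y)))// => y xy _.
by apply: (fS x); rewrite ?mem_nbrs.
Qed.

Lemma energy_ge0 S f : 0 <= energy S f f.
Proof.
rewrite mulr_ge0 ?invr_ge0// sumr_ge0// => x _; rewrite sumr_ge0// => y _.
by rewrite mulr_ge0// -expr2 sqr_ge0.
Qed.

Lemma ler_sum_uniq_sub (T : eqType) (r s : seq T) (F : T -> R) :
  uniq r -> {subset r <= s} -> (forall i, 0 <= F i) ->
  \sum_(i <- r) F i <= \sum_(i <- s) F i.
Proof.
move=> ur rs F0; elim: r s ur rs => [|i r IH] s /=.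
  by rewrite big_nil sumr_ge0.
move=> /andP[ir ur] rs; have iS : i \in s by apply: rs; rewrite mem_head.
rewrite big_cons (perm_big _ (perm_to_rem iS)) big_cons/= lerD2l; apply: IH => // j jr.
have : j \in s by apply: rs; rewrite inE jr orbT.
rewrite (perm_mem (perm_to_rem iS)) inE => /orP[/eqP ji|//].
by rewrite -ji jr in ir.
Qed.

Lemma energy_pairE S f : energy S f f =
  2^-1 * \sum_(p <- [seq (x, y) | x <- S, y <- S]) (E p.1 p.2)%:R * (f p.1 - f p.2) ^+ 2.
Proof. by rewrite big_allpairs. Qed.

Lemma energy_sub S S' f : uniq S -> {subset S <= S'} -> energy S f f <= energy S' f f.
Proof.
move=> uS SS'; rewrite !energy_pairE ler_wpM2l ?invr_ge0//; apply: ler_sum_uniq_sub.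
- by apply: allpairs_uniq => // -[a b] [c d].
- move=> [x y] /allpairsP[[a b] /= [aS bS [-> ->]]].
  by apply/allpairsP; exists (a, b); rewrite !SS'.
- by move=> p; rewrite mulr_ge0// sqr_ge0.
Qed.

(** Stands for an energy of at most [W] on the whole graph; quantifying over finite sets avoids an
    infinite sum. *)
Definition dirichlet_le f (W : R) := forall S, uniq S -> energy S f f <= W.

Lemma dirichlet_green S f : uniq S ->
  (forall x, f x != 0 -> x \in S /\ {subset nbrs E x <= S}) ->
  dirichlet_le f (\sum_(x <- S) f x * lap f x).
Proof.
move=> uS fS S' uS'.
apply: (@le_trans _ _ (energy (undup (S ++ S')) f f)).
  by apply: energy_sub => // x xS'; rewrite mem_undup mem_cat xS' orbT.
rewrite green ?undup_uniq//; last first.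
  move=> x _ /fS[_ sub] y /sub; by rewrite mem_undup mem_cat => ->.
have big0 T : uniq T -> {subset S <= T} ->
    \sum_(x <- T) f x * lap f x = \sum_(x <- S) f x * lap f x.
  move=> uT ST; rewrite (bigID (mem S))/= [X in _ + X]big1 ?addr0; last first.
    move=> x xS; apply/eqP; rewrite mulf_eq0; apply/orP; left.
    by apply: contraNT xS => /fS[].
  rewrite -big_filter; apply: perm_big; apply: uniq_perm => //.
    exact: filter_uniq.
  by move=> x; rewrite mem_filter /= andb_idr// => /ST.
by rewrite big0 ?undup_uniq// => x xS; rewrite mem_undup mem_cat xS.
Qed.

(** On a fixed finite set the energy is a polynomial in finitely many values, hence continuous under
    pointwise convergence. *)
Lemma lim_dirichlet_le (f : nat -> word n0 -> R) (W : nat -> R) g w :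
  (forall x, f^~ x @ \oo --> g x) -> W @ \oo --> w ->
  (forall n, dirichlet_le (f n) (W n)) -> dirichlet_le g w.
Proof.
move=> fg Ww fW S uS.
have h : (fun n => energy S (f n) (f n)) @ \oo --> energy S g g.
  apply: cvgM; first exact: cvg_cst.
  apply: cvg_big => [|x _]; first exact: add_continuous.
  apply: cvg_big => [|y _]; first exact: add_continuous.
  apply: cvgM; first exact: cvg_cst.
  by apply: cvgM; apply: cvgB; exact: fg.
apply: (ler_cvg_to h Ww); apply: nearW => n; exact: fW.
Qed.

Fixpoint edges x (p : seq (word n0)) : seq (word n0 * word n0) :=
  if p is y :: q then (x, y) :: (y, x) :: edges y q else [::].

Lemma mem_edges x p e : e \in edges x p -> e.1 \in x :: p /\ e.2 \in x :: p.
Proof.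
elim: p x => //= y p IH x; rewrite !inE => /or3P[/eqP->|/eqP->|/IH[]]/=.
- by rewrite !eqxx orbT.
- by rewrite !eqxx orbT.
- by rewrite !inE => -> ->; rewrite !orbT.
Qed.

Lemma uniq_edges x p : uniq (x :: p) -> uniq (edges x p).
Proof.
elim: p x => //= y p IH x /andP[xp yp]; rewrite IH// andbT.
have nx e : e \in edges y p -> e.1 != x /\ e.2 != x.
  by move=> /mem_edges[e1 e2]; split; apply: contraNneq xp => <-.
apply/andP; split; last by apply/negP => /nx[_]; rewrite eqxx.
rewrite inE negb_or; apply/andP; split; last by apply/negP => /nx[]; rewrite eqxx.
by apply: contraNneq xp => -[-> _]; rewrite mem_head.
Qed.

Lemma edges_E x p : path E x p -> forall e, e \in edges x p -> E e.1 e.2.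
Proof.
elim: p x => //= y p IH x /andP[xy yp] e; rewrite !inE => /or3P[/eqP->|/eqP->|/IH] //=.
  by rewrite E_sym.
exact.
Qed.

Lemma sum_edges_sqr f x p :
  (f x - f (last x p)) ^+ 2 <= (size p)%:R *
     (2^-1 * \sum_(e <- edges x p) (f e.1 - f e.2) ^+ 2).
Proof.
elim: p x => [|y p IH] x /=; first by rewrite subrr expr0n mul0r.
rewrite !big_cons/= -natr1.
have {}IH := IH y.
set b := f y - f (last y p) in IH *; set n := (size p)%:R in IH *.
set Q := \sum_(_ <- _) _ in IH *.
have n0' : 0 <= n by rewrite /n.
have Q0 : 0 <= Q by apply: sumr_ge0 => e _; rewrite sqr_ge0.
have -> : f x - f (last y p) = (f x - f y) + b by rewrite /b; ring.
have -> : (f y - f x) ^+ 2 = (f x - f y) ^+ 2 by rewrite -sqrrN opprB.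
move: (f x - f y) => a.
have [p0|p0] := posnP (size p).
  have n00 : n = 0 by rewrite /n p0.
  have /eqP : b ^+ 2 = 0 by apply/eqP; rewrite eq_le sqr_ge0 andbT; move: IH; rewrite n00 mul0r.
  by rewrite sqrf_eq0 n00 => /eqP ->; nra.
have n1 : 0 < n by rewrite /n ltr0n.
(* After multiplication by [n] and use of the induction hypothesis, what remains is
   [(n * a - b) ^ 2 >= 0]. *)
rewrite -(ler_pM2l n1); have := sqr_ge0 (n * a - b); nra.
Qed.

(** The path is shortened to a self-avoiding one, whose edges are distinct, so that their squared
    differences sum to at most the energy on its vertices. *)
Lemma path_dirichlet f W x p : dirichlet_le f W -> path E x p ->
  (f x - f (last x p)) ^+ 2 <= (size p)%:R * W.
Proof.
move=> fW xp; have W0 : 0 <= W by apply: le_trans (fW [::] isT); exact: energy_ge0.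
case/shortenP: xp => q xq uq qp.
have le_qp : (size q <= size p)%N by apply: uniq_leq_size => //; case/andP: uq.
apply: (le_trans (sum_edges_sqr _ _ _)).
apply: (@le_trans _ _ ((size q)%:R * W)); last by rewrite ler_wpM2r// ler_nat.
rewrite ler_wpM2l//; apply: le_trans (fW (x :: q) uq).
rewrite energy_pairE ler_wpM2l ?invr_ge0//.
rewrite (_ : \sum_(e <- edges x q) (f e.1 - f e.2) ^+ 2 =
   \sum_(e <- edges x q) (E e.1 e.2)%:R * (f e.1 - f e.2) ^+ 2); last first.
  by apply: eq_big_seq => e /(edges_E xq) ->; rewrite mul1r.
apply: ler_sum_uniq_sub; first exact: uniq_edges.
- move=> [a b] /mem_edges[aq bq]; by apply/allpairsP; exists (a, b).
- by move=> e; rewrite mulr_ge0// sqr_ge0.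
Qed.

End Energy.

(** * Transition operators killed outside a set, and their kernels *)

Section Kernel.
Variables (R : realType) (n0 : nat) (V : pred (word n0)) (E : rel (word n0)).
Hypothesis Esub : subgraph_of_B V E.
Hypothesis mu_gt0 : forall x, V x -> 0 < mu R E x.
Implicit Types (x y z : word n0) (f g : word n0 -> R) (S : seq (word n0))
  (A : pred (word n0)).

Let mu := mu R E.

(** One step of the walk killed outside [A]; [A = predT] gives the free walk. *)
Definition Pop A f y : R := (A y)%:R * \sum_(z <- nbrs E y) f z / mu y.

(** The unit mass at [x] as a density with respect to [mu]. *)
Definition dlt x y : R := (x == y)%:R / mu x.

(* [ker A k x y] is P^x(X_k = y, X_1, ..., X_k in A) / mu_y. *)
Definition ker A k x : word n0 -> R := iter k (Pop A) (dlt x).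

Definition ip S f g : R := \sum_(x <- S) f x * g x * mu x.

Lemma Pop_ge0 A f : (forall x, 0 <= f x) -> forall x, 0 <= Pop A f x.
Proof.
move=> f0 x; rewrite mulr_ge0// sumr_ge0// => z _.
by rewrite mulr_ge0// invr_ge0 mu_ge0.
Qed.

Lemma Pop_mono A f g : (forall x, f x <= g x) -> forall x, Pop A f x <= Pop A g x.
Proof.
move=> fg x; rewrite ler_wpM2l// ler_sum// => z _.
by rewrite ler_wpM2r// invr_ge0 mu_ge0.
Qed.

Lemma Pop_le_free A f x : (forall y, 0 <= f y) -> Pop A f x <= Pop predT f x.
Proof.
move=> f0; rewrite /Pop ler_wpM2r ?ler_nat ?leq_b1// sumr_ge0// => z _.
by rewrite mulr_ge0// invr_ge0 mu_ge0.
Qed.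

Lemma Pop_le A f c : 0 <= c -> (forall x, f x <= c) -> forall x, Pop A f x <= c.
Proof.
move=> c0 f1 x; apply: (@le_trans _ _ (Pop A (fun=> c) x)); first exact: Pop_mono.
rewrite /Pop big_const_seq count_predT iter_addr_0 -[X in _ * X]mulr_natl.
rewrite -/(Defs.mu R E x) -/mu.
have [->|mx] := eqVneq (mu x) 0; first by rewrite invr0 !mulr0.
by rewrite [mu x * _]mulrC divfK//; case: (A x); rewrite ?mul1r ?mul0r.
Qed.

Lemma mu_Pop A f x : Pop A f x * mu x = (A x)%:R * \sum_(z <- nbrs E x) f z.
Proof.
rewrite /Pop -mulr_suml -!mulrA; congr (_ * _).
have [mx|mx] := eqVneq (mu x) 0; last by rewrite mulVf ?mulr1.
rewrite mx invr0 mul0r mulr0; move: mx => /eqP; rewrite pnatr_eq0 size_eq0 => /eqP ->.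
by rewrite big_nil.
Qed.

Lemma Pop_sum A (I : Type) (r : seq I) (F : I -> word n0 -> R) x :
  Pop A (fun y => \sum_(i <- r) F i y) x = \sum_(i <- r) Pop A (F i) x.
Proof.
rewrite /Pop -mulr_sumr exchange_big/=; congr (_ * _).
by apply: eq_bigr => z _; rewrite mulr_suml.
Qed.

Lemma Pop_scale A c f x : Pop A (fun y => c * f y) x = c * Pop A f x.
Proof.
rewrite /Pop mulrCA; congr (_ * _); rewrite mulr_sumr.
by apply: eq_bigr => z _; rewrite mulrA.
Qed.

Lemma dlt_ge0 x y : 0 <= dlt x y.
Proof. by rewrite mulr_ge0// invr_ge0 mu_ge0. Qed.

Lemma ker_ge0 A k x y : 0 <= ker A k x y.
Proof.
rewrite /ker; elim: k y => [|k IH] y /=; first exact: dlt_ge0.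
exact: Pop_ge0.
Qed.

Lemma kerS A k x : ker A k.+1 x = Pop A (ker A k x). Proof. by []. Qed.

(** [pk] unrolls the first step from [x], so as a function of [x] it iterates the transition
    operator on the indicator of [y]; hence the swapped arguments. *)
Lemma pk_ker k x y : pk R E k x y / mu y = ker predT k y x.
Proof.
elim: k x => [|k IH] x; first by rewrite /ker /= /dlt eq_sym.
rewrite kerS /Pop /= mul1r mulr_suml; apply: eq_bigr => z _.
by rewrite -IH mulrAC.
Qed.

Lemma pstay_iter (B : set (word n0)) A k x : (forall y, `[< B y >] = A y) ->
  pstay R E B k x = iter k (Pop A) (fun y => (A y)%:R) x.
Proof.
move=> BA; elim: k x => [|k IH] x /=; first by rewrite BA.
by rewrite /Pop BA; congr (_ * _); apply: eq_bigr => z _; rewrite IH.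
Qed.

(** The indicator of [S] is the sum of [mu y * dlt y] over [S], and the operator is linear. With [A]
    equal to [S] this describes survival in [S]; with [predT], presence in [S] at time [k]. *)
Lemma iter_Pop_mem A S k x : uniq S -> (forall y, y \in S -> V y) ->
  iter k (Pop A) (fun y => (y \in S)%:R) x = \sum_(y <- S) mu y * ker A k y x.
Proof.
move=> uS SV; elim: k x => [|k IH] x /=.
  under eq_big_seq => y yS.
    rewrite /ker/= /dlt mulrCA divff ?mulr1; last by rewrite gt_eqF// mu_gt0// SV.
    over.
  have [xS|xS] := boolP (x \in S).
    rewrite (bigD1_seq x)//= eqxx big1 ?addr0// => y /negPf.
    by rewrite eq_sym => ->.
  by rewrite big1_seq// => y /andP[_ yS]; case: eqP => // yx; rewrite -yx yS in xS.
have -> : iter k (Pop A) (fun y => (y \in S)%:R) = (fun x => \sum_(y <- S) mu y * ker A k y x).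
  exact/funext.
by rewrite Pop_sum; apply: eq_bigr => y _; rewrite Pop_scale.
Qed.

Definition supp_in (P : pred (word n0)) f := forall x, f x != 0 -> P x.

Lemma sum_supp (P : pred (word n0)) S (F : word n0 -> R) :
  (forall x, F x != 0 -> P x) -> \sum_(x <- S | P x) F x = \sum_(x <- S) F x.
Proof.
move=> FP; rewrite big_mkcond/=; apply: eq_bigr => x _; case: ifPn => // Px.
by apply/esym/eqP; apply: contraNT Px; exact: FP.
Qed.

(** Reversibility: both sides equal the sum of [f x * g y] over ordered edges, the killing factor
    being 1 on the supports. *)
Lemma ip_Pop S A f g : uniq S -> supp_in (mem S) f -> supp_in (mem S) g ->
  supp_in A f -> supp_in A g -> ip S f (Pop A g) = ip S (Pop A f) g.
Proof.
move=> uS fS gS fA gA.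
have key u v : supp_in (mem S) v -> supp_in A u ->
    ip S u (Pop A v) = \sum_(x <- S) \sum_(y <- S) (E x y)%:R * (u x * v y).
  move=> vS uA; apply: eq_bigr => x _; rewrite -mulrA mu_Pop.
  rewrite (@sum_nbrsE _ _ _ _ Esub S)// => [|y _ /vS//].
  have [->|ux] := eqVneq (u x) 0.
    by rewrite mul0r big1// => y _; rewrite mul0r mulr0.
  rewrite uA// mul1r mulr_sumr; apply: eq_bigr => y _.
  by rewrite mulrCA.
rewrite key//.
have -> : ip S (Pop A f) g = ip S g (Pop A f).
  by apply: eq_bigr => x _; rewrite (mulrC (g x)).
rewrite key// exchange_big; apply: eq_bigr => x _; apply: eq_bigr => y _.
by rewrite (E_sym Esub) (mulrC (f _)).
Qed.

Lemma ker_supp A k x : A x -> supp_in A (ker A k x).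
Proof.
move=> Ax; case: k => [|k] y.
  by rewrite /ker/= /dlt; case: (x =P y) => [<-//|_]; rewrite mul0r eqxx.
by rewrite kerS /Pop; case: (A y) => //; rewrite mul0r eqxx.
Qed.

Lemma ip_dlt S x g : uniq S -> V x -> x \in S -> ip S (dlt x) g = g x.
Proof.
move=> uS Vx xS; rewrite /ip (bigD1_seq x)//= big1 ?addr0; last first.
  by move=> y /negPf; rewrite /dlt eq_sym => ->; rewrite !mul0r.
rewrite /dlt eqxx mul1r mulrC mulrA divff ?mul1r// gt_eqF//.
exact: mu_gt0.
Qed.

(** Self-adjointness moves the [j] steps one at a time onto the other kernel: the Chapman-Kolmogorov
    identity, within a finite set [S] containing all supports involved. *)
Lemma ip_ker S A x y N : uniq S -> V x -> A x -> A y -> x \in S ->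
  (forall k, (k <= N)%N -> supp_in (mem S) (ker A k x)) ->
  (forall k, (k <= N)%N -> supp_in (mem S) (ker A k y)) ->
  forall j k, (j + k <= N)%N -> ip S (ker A j x) (ker A k y) = ker A (j + k) y x.
Proof.
move=> uS Vx Ax Ay xS Sx Sy; elim=> [|j IH] k jk; first exact: ip_dlt.
rewrite kerS -ip_Pop//; last 4 first.
- by apply: Sx; rewrite (leq_trans _ jk)// addSn leqW// leq_addr.
- by apply: Sy; rewrite (leq_trans _ jk)// leq_addl.
- exact: ker_supp.
- exact: ker_supp.
by rewrite -kerS IH addnS -addSn.
Qed.

(** The ball of radius [n] as a duplicate-free list, grown by one layer of neighbours at a time; it
    contains the support of the [n]-step kernel from [x]. *)
Fixpoint bseq x n : seq (word n0) :=
  if n is m.+1 then undup (bseq x m ++ flatten [seq nbrs E y | y <- bseq x m])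
  else [:: x].

Lemma bseq_uniq x n : uniq (bseq x n).
Proof. by case: n => //= n; exact: undup_uniq. Qed.

Lemma bseqS x n : {subset bseq x n <= bseq x n.+1}.
Proof. by move=> y yn; rewrite /= mem_undup mem_cat yn. Qed.

Lemma bseq_mono x m n : (m <= n)%N -> {subset bseq x m <= bseq x n}.
Proof.
move=> /subnK <-; elim: (n - m)%N => // k IH y /IH.
by rewrite addSn; exact: bseqS.
Qed.

Lemma bseq_center x n : x \in bseq x n.
Proof. by apply: (@bseq_mono x 0); rewrite ?mem_head. Qed.

Lemma bseq_nbrs x n y z : y \in bseq x n -> E y z -> z \in bseq x n.+1.
Proof.
move=> yn yz; rewrite /= mem_undup mem_cat; apply/orP; right.
by apply/flatten_mapP; exists y => //; rewrite (mem_nbrs Esub).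
Qed.

Lemma ker_bseq A k x : supp_in (mem (bseq x k)) (ker A k x).
Proof.
elim: k => [|k IH] y.
  by rewrite /ker/= /dlt; case: (x =P y) => [<-|_]; rewrite ?mul0r ?eqxx ?mem_head.
rewrite kerS /Pop => h.
have /hasP[z zy zk] : has (fun z => ker A k x z != 0) (nbrs E y).
  apply: contraNT h => /hasPn h; rewrite big1_seq ?mulr0// => z /andP[_ /h].
  by rewrite negbK => /eqP ->; rewrite mul0r.
apply: (@bseq_nbrs _ _ z); first exact: IH.
by rewrite (E_sym Esub) -(mem_nbrs Esub).
Qed.

Lemma ker_sym A k x y : V x -> V y -> A x -> A y -> ker A k x y = ker A k y x.
Proof.
move=> Vx Vy Ax Ay; pose S := undup (bseq x k ++ bseq y k).
have uS : uniq S by exact: undup_uniq.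
have Sx j : (j <= k)%N -> supp_in (mem S) (ker A j x).
  move=> jk z /ker_bseq /(bseq_mono jk) zk.
  by rewrite /= mem_undup mem_cat zk.
have Sy j : (j <= k)%N -> supp_in (mem S) (ker A j y).
  move=> jk z /ker_bseq /(bseq_mono jk) zk.
  by rewrite /= mem_undup mem_cat zk orbT.
have xS : x \in S by rewrite mem_undup mem_cat bseq_center.
have yS : y \in S by rewrite mem_undup mem_cat bseq_center orbT.
have := ip_ker uS Vx Ax Ay xS Sx Sy (j := k) (k := 0%N).
rewrite addn0 => <-//.
rewrite -[LHS](ip_dlt (S := S))//.
by apply: eq_bigr => z _; rewrite (mulrC (dlt y z)).
Qed.

Lemma ip_sum S (c c' : nat -> R) (F G : nat -> word n0 -> R) n :
  ip S (fun y => \sum_(k < n) c k * F k y) (fun y => \sum_(k < n) c' k * G k y) =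
  \sum_(j < n) \sum_(k < n) c j * c' k * ip S (F j) (G k).
Proof.
transitivity (\sum_(x <- S) \sum_(j < n) \sum_(k < n) c j * c' k * (F j x * G k x * mu x)).
  apply: eq_bigr => x _; rewrite mulr_suml mulr_suml; apply: eq_bigr => j _.
  rewrite mulr_sumr mulr_suml; apply: eq_bigr => k _; ring.
rewrite exchange_big; apply: eq_bigr => j _; rewrite exchange_big; apply: eq_bigr => k _.
by rewrite mulr_sumr.
Qed.

(** * Norm and energy of linear combinations of kernels *)

Section Combination.
Variables (A : pred (word n0)) (x : word n0) (c : nat -> R) (n : nat).
Hypotheses (Vx : V x) (Ax : A x).

Let h k := ker A k x.
Let F y := \sum_(k < n) c k * h k y.
(** The radius leaves room for the kernels of index up to [j + k + 2] met in second differences. *)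
Let S := bseq x (n + n).+2.

Let uS : uniq S. Proof. exact: bseq_uniq. Qed.
Let xS : x \in S. Proof. exact: bseq_center. Qed.

Let hS k : (k <= (n + n).+2)%N -> supp_in (mem S) (h k).
Proof. by move=> kn y /ker_bseq; exact: bseq_mono. Qed.

Let ip_h j k : (j + k <= (n + n).+2)%N -> ip S (h j) (h k) = h (j + k)%N x.
Proof. exact: ip_ker. Qed.

Let jk_le (j k : 'I_n) : (j + k <= n + n)%N.
Proof. by apply: leq_add; exact: ltnW. Qed.

Lemma ip_comb : ip S F F = \sum_(j < n) \sum_(k < n) c j * c k * h (j + k)%N x.
Proof.
rewrite ip_sum; apply: eq_bigr => j _; apply: eq_bigr => k _.
by rewrite ip_h// (leq_trans (jk_le j k))// leqW.
Qed.

(** The sum is the squared norm of the combination of the differences [h k - h k.+1]. It will give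
    the convexity of [s |-> q_s(x, x)]. *)
Lemma sum_second_diff_ge0 :
  0 <= \sum_(j < n) \sum_(k < n)
    c j * c k * (h (j + k).+2 x - h (j + k).+1 x - (h (j + k).+1 x - h (j + k)%N x)).
Proof.
have <- : ip S (fun y => \sum_(k < n) c k * (h k y - h k.+1 y))
  (fun y => \sum_(k < n) c k * (h k y - h k.+1 y)) =
   \sum_(j < n) \sum_(k < n)
    c j * c k * (h (j + k).+2 x - h (j + k).+1 x - (h (j + k).+1 x - h (j + k)%N x)).
  rewrite (ip_sum _ _ _ (fun k y => h k y - h k.+1 y) (fun k y => h k y - h k.+1 y)).
  apply: eq_bigr => j _; apply: eq_bigr => k _; congr (_ * _).
  have bil (u v w : word n0 -> R) : ip S (fun y => u y - v y) w = ip S u w - ip S v w.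
    rewrite /ip -sumrB; apply: eq_bigr => z _; ring.
  have bil' (u v w : word n0 -> R) : ip S w (fun y => u y - v y) = ip S w u - ip S w v.
    rewrite /ip -sumrB; apply: eq_bigr => z _; ring.
  have jk := jk_le j k.
  rewrite bil !bil' !ip_h ?addSn ?addnS ?ltnS//; [ring|by rewrite leqW|by rewrite leqW|].
  by rewrite (leq_trans jk)// leqW.
apply: sumr_ge0 => y _; rewrite mulr_ge0 ?mu_ge0//.
by rewrite -expr2 sqr_ge0.
Qed.

Lemma F_supp y : F y != 0 -> A y /\ y \in bseq x n.
Proof.
move=> Fy; have /existsP[k] : [exists k : 'I_n, h k y != 0].
  apply: contraNT Fy; rewrite negb_exists => /forallP hk.
  by rewrite /F big1// => k _; have := hk k; rewrite negbK => /eqP ->; rewrite mulr0.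
move=> hk; split; first by apply: ker_supp hk.
by apply: (@bseq_mono _ k); [exact: ltnW|exact: ker_bseq hk].
Qed.

(** Green's formula yields the pairing of [F] with its Laplacian. On the support of [F], which lies
    in [A], the free and killed operators agree, so one step raises the index of each kernel by
    one. *)
Lemma dirichlet_comb : dirichlet_le E F
  (\sum_(j < n) \sum_(k < n) c j * c k * (h (j + k)%N x - h (j + k).+1 x)).
Proof.
have -> : \sum_(j < n) \sum_(k < n) c j * c k * (h (j + k)%N x - h (j + k).+1 x) =
    \sum_(y <- S) F y * lap E F y.
  transitivity (ip S F (fun y => \sum_(k < n) c k * (h k y - h k.+1 y))).
    rewrite (ip_sum _ _ _ _ (fun k y => h k y - h k.+1 y)).
    apply: eq_bigr => j _; apply: eq_bigr => k _; congr (_ * _).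
    have jk := jk_le j k.
    transitivity (ip S (h j) (h k) - ip S (h j) (h k.+1)).
      by rewrite (ip_h (leqW (leqW jk))) ip_h ?addnS// ltnS leqW.
    by rewrite /ip -sumrB; apply: eq_bigr => z _; ring.
  apply: eq_bigr => y _; have [->|Fy] := eqVneq (F y) 0; first by rewrite !mul0r.
  rewrite -mulrA; congr (_ * _).
  have [Ay _] := F_supp Fy.
  have nE : \sum_(z <- nbrs E y) F z = Pop A F y * mu y by rewrite mu_Pop Ay mul1r.
  rewrite /lap nE /F Pop_sum -/mu [RHS]addrC mulrC.
  rewrite [X in _ = _ + X]mulrC addrC -mulrBl mulrC; congr (_ * _).
  rewrite -sumrB; apply: eq_bigr => k _.
  by rewrite Pop_scale mulrBr.
apply: (dirichlet_green Esub) => // y /F_supp[_ yn]; split.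
  by apply: bseq_mono yn; rewrite -addnS -addnS leq_addr.
move=> z; rewrite (mem_nbrs Esub) => yz.
by apply: (@bseq_mono _ n.+1); [rewrite -addSn leqW// leq_addr|exact: bseq_nbrs yz].
Qed.

End Combination.
End Kernel.

(** * Heat kernel: gradient estimate, total mass, and a diagonal lower bound *)

Section HeatKernel.
Variables (R : realType) (n0 : nat) (V : pred (word n0)) (E : rel (word n0)).
Hypothesis Esub : subgraph_of_B V E.
Hypothesis Econn : connected_graph V E.
Hypothesis mu_gt0 : forall x, V x -> 0 < mu R E x.
Implicit Types (x y z : word n0) (S : seq (word n0)) (t : R).

Lemma gdist_path x y : V x -> V y ->
  exists p, [/\ path E x p, last x p = y & size p = gdist E x y].
Proof.
move=> Vx Vy; rewrite /gdist; case: pselect => [h|[]]; last first.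
  have [p [xp py]] := Econn Vx Vy.
  by exists (size p); apply/asboolP; exists p.
case: ex_minnP => n /asboolP[p [pn xp py]] _.
by exists p.
Qed.

Lemma gdist_le x p : path E x p -> (gdist E x (last x p) <= size p)%N.
Proof.
move=> xp; rewrite /gdist; case: pselect => // h.
by case: ex_minnP => n _; apply; apply/asboolP; exists p.
Qed.

Lemma dirichlet_gdist (f : word n0 -> R) W x y : dirichlet_le E f W -> V x -> V y ->
  (f x - f y) ^+ 2 <= (gdist E x y)%:R * W.
Proof.
move=> fW Vx Vy; have [p [xp <- <-]] := gdist_path Vx Vy.
exact: path_dirichlet Esub _ _ _ _ fW xp.
Qed.

Lemma ker_le (A : pred (word n0)) k x y : ker R E A k x y <= (mu R E x)^-1.
Proof.
rewrite /ker; elim: k y => [|k IH] y /=.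
  rewrite /dlt; case: (x == y); rewrite ?mul1r// mul0r invr_ge0.
  exact: mu_ge0.
by apply: Pop_le => //; rewrite invr_ge0 mu_ge0.
Qed.

Lemma norm_ker (A : pred (word n0)) x y k : `|ker R E A k x y| <= (mu R E x)^-1.
Proof. by rewrite ger0_norm ?ker_le// ker_ge0. Qed.

Lemma qkerE t x y : V x -> V y ->
  qker E t x y = Po (fun k => ker R E predT k x y) t.
Proof.
move=> Vx Vy; rewrite /qker /pY.
have my : mu R E y != 0 by rewrite gt_eqF// mu_gt0.
have -> : (fun k => poisson t k * pk R E k x y) =
    mu R E y *: (fun k => poisson t k * ker R E predT k x y).
  apply/funext => k; have -> : forall c (f : nat -> R), (c *: f) k = c * f k by [].
  rewrite (ker_sym Esub mu_gt0)// -pk_ker -/(mu R E y).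
  by field.
rewrite lim_seriesZ; last exact: is_cvg_Po (norm_ker _ _ _).
by rewrite /GRing.scale/= mulrC mulrA mulVf// mul1r.
Qed.

(** The energy of [q_t(x, .)] is controlled by minus the derivative of [s |-> q_s(x, x)] at [2 t],
    which convexity bounds. The energy estimate passes to the limit from partial sums over the
    number of jumps. *)
Lemma dirichlet_heat t x : V x -> 0 < t ->
  dirichlet_le E (fun y => Po (fun k => ker R E predT k x y) t)
    (Po (fun k => ker R E predT k x x) t / t).
Proof.
move=> Vx t0; pose a k := ker R E predT k x x.
have aM : forall k, `|a k| <= (mu R E x)^-1 by move=> k; exact: norm_ker.
have daM : forall k, `|a k - a k.+1| <= (mu R E x)^-1 + (mu R E x)^-1.
  by move=> k; rewrite distrC; exact: norm_shift_diff.
have le : Po (fun k => a k - a k.+1) (t + t) <= Po a t / t.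
  rewrite ler_pdivlMr// mulrC; apply: (Po_convex_slope t0 aM).
    by move=> s s0; apply: Po_ge0 aM _ => // k; exact: ker_ge0.
  (* Splitting [s] in half writes the second derivative at [s] as a limit of squared norms. *)
  move=> s s0; have s2 : 0 <= s / 2 by rewrite divr_ge0.
  have bM k : `|a k.+2 - a k.+1 - (a k.+1 - a k)| <=
      ((mu R E x)^-1 + (mu R E x)^-1) + ((mu R E x)^-1 + (mu R E x)^-1).
    exact: norm_shift_diff (norm_shift_diff aM) k.
  have := cvg_Po_double s2 bM; rewrite -splitr => h.
  apply: (ler_cvg_to (cvg_cst _) h); apply: nearW => N.
  exact: (sum_second_diff_ge0 Esub mu_gt0 (fun k => poisson (s / 2) k) N (A := predT) Vx).
move=> S uS; apply: le_trans le.
apply: (@lim_dirichlet_le _ _ E (fun N y => \sum_(k < N) poisson t k * ker R E predT k x y)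
  _ _ _ _ (cvg_Po_double (ltW t0) daM)) => //.
  move=> y; have := @cvg_Po _ (fun k => ker R E predT k x y) _ t (norm_ker _ _ _).
  rewrite (_ : series _ = (fun N => \sum_(k < N) poisson t k * ker R E predT k x y))//.
  by apply/funext => N; rewrite /series/= big_mkord.
move=> N; exact: (dirichlet_comb Esub mu_gt0).
Qed.

Lemma qker_gradient t x y : V x -> V y -> 0 < t ->
  (qker E t x x - qker E t x y) ^+ 2 <= (gdist E x y)%:R * (qker E t x x / t).
Proof.
move=> Vx Vy t0; rewrite !qkerE//.
exact: (dirichlet_gdist (dirichlet_heat Vx t0)).
Qed.

Lemma sum_ker_le1 (A : pred (word n0)) S k x : uniq S -> {subset S <= V} ->
  \sum_(y <- S) mu R E y * ker R E A k y x <= 1.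
Proof.
move=> uS SV; rewrite -(iter_Pop_mem mu_gt0)//.
elim: k x => [|k IH] x /=; first by rewrite lern1 leq_b1.
exact: Pop_le.
Qed.

Lemma qker_ge0 t x y : V x -> V y -> 0 <= t -> 0 <= qker E t x y.
Proof.
move=> Vx Vy t0; rewrite qkerE//; apply: (@Po_ge0 _ _ (mu R E x)^-1) => // k.
  exact: norm_ker.
exact: ker_ge0.
Qed.

Lemma sum_qker_le1 S t x : uniq S -> {subset S <= V} -> V x -> 0 <= t ->
  \sum_(y <- S) mu R E y * qker E t x y <= 1.
Proof.
move=> uS SV Vx t0.
have h : (fun N => \sum_(y <- S) mu R E y * series (fun k => poisson t k * ker R E predT k x y) N)
    @ \oo --> \sum_(y <- S) mu R E y * Po (fun k => ker R E predT k x y) t.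
  apply: cvg_big => [|y _]; first exact: add_continuous.
  apply: cvgM; first exact: cvg_cst.
  exact: cvg_Po (norm_ker _ _ _).
rewrite (_ : \sum_(y <- S) _ = \sum_(y <- S) mu R E y * Po (fun k => ker R E predT k x y) t);
  last by apply: eq_big_seq => y /SV Vy; rewrite qkerE.
apply: (ler_cvg_to h (cvg_cst _)); apply: nearW => N.
apply: le_trans (poisson_sum_le1 N t0).
rewrite /series/=; under eq_bigr do rewrite mulr_sumr.
rewrite exchange_big/=; apply: ler_sum => k _.
rewrite (_ : \sum_(y <- S) _ = poisson t k * \sum_(y <- S) mu R E y * ker R E predT k y x).
  by rewrite -[leRHS]mulr1 ler_wpM2l ?poisson_ge0// sum_ker_le1.
rewrite mulr_sumr; apply: eq_big_seq => y /SV Vy.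
by rewrite (ker_sym Esub mu_gt0)//; ring.
Qed.

(** Lagrange's identity: the gap is half the sum of [w i * w j * (f i - f j) ^ 2] over ordered
    pairs. *)
Lemma weighted_CS (T : Type) (r : seq T) (w f : T -> R) : (forall i, 0 <= w i) ->
  (\sum_(i <- r) w i * f i) ^+ 2 <= (\sum_(i <- r) w i) * \sum_(i <- r) w i * f i ^+ 2.
Proof.
move=> w0.
have : 0 <= \sum_(i <- r) \sum_(j <- r) w i * w j * (f i - f j) ^+ 2.
  by apply: sumr_ge0 => i _; apply: sumr_ge0 => j _; rewrite mulr_ge0 ?sqr_ge0// mulr_ge0.
set W := \sum_(i <- r) w i; set Q := \sum_(i <- r) w i * f i ^+ 2; set M := \sum_(i <- r) w i * f i.
have -> : \sum_(i <- r) \sum_(j <- r) w i * w j * (f i - f j) ^+ 2 =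
    Q * W + W * Q - 2 * (M * M).
  rewrite !big_distrlr/= mulr_sumr -big_split/= -sumrB; apply: eq_bigr => i _.
  rewrite mulr_sumr -big_split/= -sumrB; apply: eq_bigr => j _; ring.
nra.
Qed.

(** By hypothesis [Po b t] is at most the sum of [mu y * q_t(x, y)] over [S]. Cauchy-Schwarz
    applies, and the sum of [mu y * q_t(x, y) ^ 2] over all [y] is [q_{2t}(x, x)]; partial sums in
    the number of jumps keep everything finite. *)
Lemma sqr_Po_le_qker S (b : nat -> R) t x : uniq S -> {subset S <= V} -> V x -> 0 <= t ->
  (forall k, 0 <= b k <= \sum_(y <- S) mu R E y * ker R E predT k y x) ->
  (Po b t) ^+ 2 <= (\sum_(y <- S) mu R E y) * qker E (t + t) x x.
Proof.
move=> uS SV Vx t0 bS.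
have b0 k : 0 <= b k by have /andP[] := bS k.
have bM k : `|b k| <= 1.
  by rewrite ger0_norm//; have /andP[_ /le_trans->//] := bS k; exact: sum_ker_le1.
have h1 : (fun N => series (fun k => poisson t k * b k) N ^+ 2) @ \oo --> Po b t ^+ 2.
  by apply: cvgM; exact: cvg_Po bM.
have h2 : (fun N => (\sum_(y <- S) mu R E y) *
    \sum_(j < N) \sum_(i < N) poisson t j * poisson t i * ker R E predT (j + i) x x) @ \oo
    --> (\sum_(y <- S) mu R E y) * qker E (t + t) x x.
  apply: cvgM; first exact: cvg_cst.
  rewrite qkerE//; apply: (@cvg_Po_double _ (fun k => ker R E predT k x x) (mu R E x)^-1) => // k.
  exact: norm_ker.
apply: (ler_cvg_to h1 h2); apply: nearW => N.
rewrite -(ip_comb Esub mu_gt0 (fun k => poisson t k) N (A := predT) Vx)//.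
set F := fun y : word n0 => \sum_(k < N) poisson t k * ker R E predT k x y; set T := bseq _ _ _.
have m0 y : 0 <= mu R E y by exact: mu_ge0.
have bF : series (fun k => poisson t k * b k) N <= \sum_(y <- S) mu R E y * F y.
  rewrite /series/= big_mkord; under [leRHS]eq_bigr do rewrite mulr_sumr.
  rewrite exchange_big/=; apply: ler_sum => k _.
  rewrite (_ : \sum_(y <- S) _ = poisson t k * \sum_(y <- S) mu R E y * ker R E predT k y x).
    by rewrite ler_wpM2l ?poisson_ge0//; have /andP[] := bS k.
  rewrite mulr_sumr; apply: eq_big_seq => y /SV Vy.
  by rewrite (ker_sym Esub mu_gt0)//; ring.
have s0 : 0 <= series (fun k => poisson t k * b k) N.
  by apply: sumr_ge0 => k _; rewrite mulr_ge0// poisson_ge0.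
apply: (@le_trans _ _ ((\sum_(y <- S) mu R E y * F y) ^+ 2)).
  by rewrite lerXn2r ?nnegrE// (le_trans s0).
apply: (le_trans (weighted_CS _ _ m0)); rewrite ler_wpM2l ?sumr_ge0//.
rewrite -(@sum_supp _ _ (mem T)); last first.
  move=> y; rewrite mulf_eq0 negb_or sqrf_eq0 => /andP[_ Fy].
  have [_ yN] := F_supp Esub (A := predT) isT Fy.
  by apply: bseq_mono yN; rewrite -addnS -addnS leq_addr.
rewrite -big_filter (_ : ip _ _ _ _ = \sum_(y <- T) mu R E y * F y ^+ 2).
  apply: ler_sum_uniq_sub; first exact: filter_uniq.
    by move=> y; rewrite mem_filter => /andP[].
  by move=> y; rewrite mulr_ge0// sqr_ge0.
by apply: eq_bigr => y _; ring.
Qed.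

End HeatKernel.

(** * The walk killed on leaving a finite set, and its Green function *)

Section KilledWalk.
Variables (R : realType) (n0 : nat) (V : pred (word n0)) (E : rel (word n0)).
Hypothesis Esub : subgraph_of_B V E.
Hypothesis mu_gt0 : forall x, V x -> 0 < mu R E x.
Variable S : seq (word n0).
Hypotheses (uS : uniq S) (SV : {subset S <= V}).
Hypothesis exitS : forall y, y \in S -> exists p, path E y p /\ last y p \notin S.
Implicit Types (x y z : word n0) (f : word n0 -> R).

Let A : pred (word n0) := fun y => y \in S.
Let mu := mu R E.
Let kerA := ker R E A.

(** The probability that the jump chain from [x] stays in [S] up to step [k]. *)
Definition pst k x : R := iter k (Pop E A) (fun y => (A y)%:R) x.

Lemma pst_ge0 k x : 0 <= pst k x.
Proof.
rewrite /pst; elim: k x => [|k IH] x /=; first by rewrite ler0n.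
exact: Pop_ge0.
Qed.

Lemma pst_le1 k x : pst k x <= 1.
Proof.
rewrite /pst; elim: k x => [|k IH] x /=; first by rewrite lern1 leq_b1.
exact: Pop_le.
Qed.

Lemma norm_pst x k : `|pst k x| <= 1.
Proof. by rewrite ger0_norm ?pst_le1 ?pst_ge0. Qed.

Lemma pst_out k x : x \notin S -> pst k x = 0.
Proof.
by move=> xS; case: k => [|k]; rewrite /pst/= /Pop /A (negPf xS)// mul0r.
Qed.

Lemma pst_sum k x : pst k x = \sum_(y <- S) mu y * kerA k y x.
Proof. by rewrite /pst (iter_Pop_mem mu_gt0). Qed.

Lemma pst_le_free k x : pst k x <= \sum_(y <- S) mu y * ker R E predT k y x.
Proof.
rewrite -(iter_Pop_mem mu_gt0)//.
rewrite /pst; elim: k x => [|k IH] x //=.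
apply: (@le_trans _ _ (Pop E predT (pst k) x)); last exact: Pop_mono.
by apply: Pop_le_free => y; exact: pst_ge0.
Qed.

(* Markov property at time [n]: the expected remaining lifetime is at most [U]. *)
Lemma pst_tail U n m x : (forall z k, z \in S -> \sum_(i < k) pst i z <= U) ->
  \sum_(k < m) pst (n + k) x <= U * pst n x.
Proof.
move=> hU; elim: n x => [|n IH] x.
  rewrite /pst/= /A; have [xS|xS] := boolP (x \in S).
    by rewrite mulr1; exact: hU.
  by rewrite mulr0 big1// => k _; exact: (@pst_out k).
rewrite -[leRHS]Pop_scale.
rewrite (_ : \sum_(k < m) _ = Pop E A (fun y => \sum_(k < m) pst (n + k) y) x).
  exact: Pop_mono.
by rewrite Pop_sum; apply: eq_bigr => k _; rewrite addSn.
Qed.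

Lemma pst_lower U n m x : (forall z k, z \in S -> \sum_(i < k) pst i z <= U) ->
  \sum_(k < m) pst k x <= n%:R + U * pst n x.
Proof.
move=> hU; apply: (@le_trans _ _ (\sum_(k < n + m) pst k x)).
  rewrite addnC big_split_ord/= lerDl sumr_ge0// => k _; exact: pst_ge0.
rewrite big_split_ord/= lerD//; last exact: pst_tail.
rewrite -[leRHS]mulr1 mulr_natl -[in leRHS](card_ord n) -sumr_const ler_sum// => k _.
exact: pst_le1.
Qed.

(** The Green function truncated to [n] terms, so that bounds can be proved on finite sums before
    the limit is known to exist. *)
Definition gre n x y : R := \sum_(k < n) kerA k x y.

Lemma gre_ge0 n x y : 0 <= gre n x y.
Proof. by apply: sumr_ge0 => k _; exact: ker_ge0. Qed.

Lemma ker_out k x y : x \in S -> y \notin S -> kerA k x y = 0.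
Proof.
move=> xS yS; apply/eqP; apply: contraNT yS.
exact: (ker_supp (A := A)).
Qed.

Lemma gre_out n x y : x \in S -> y \notin S -> gre n x y = 0.
Proof. by move=> xS yS; rewrite /gre big1// => k _; exact: ker_out. Qed.

Lemma gre_sym n x y : x \in S -> y \in S -> gre n x y = gre n y x.
Proof.
move=> xS yS; apply: eq_bigr => k _.
by apply: (ker_sym Esub mu_gt0) => //; exact: SV.
Qed.

Lemma sum_pst n x : x \in S -> \sum_(k < n) pst k x = \sum_(y <- S) mu y * gre n x y.
Proof.
move=> xS; under eq_bigr do rewrite pst_sum.
rewrite exchange_big/=; apply: eq_big_seq => y yS.
by rewrite gre_sym// /gre mulr_sumr.
Qed.

(** With all coefficients equal to 1 the energy bound is a double sum that telescopes in [k],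
    leaving [kerA j x x - kerA (j + n) x x] for each [j]. *)
Lemma dirichlet_gre n x : x \in S -> dirichlet_le E (gre n x) (gre n x x).
Proof.
move=> xS T uT.
have := dirichlet_comb Esub mu_gt0 (fun=> 1) n (SV xS) (xS : A x) uT.
have -> : (fun y => \sum_(k < n) 1 * ker R E A k x y) = gre n x.
  by apply/funext => y; apply: eq_bigr => k _; rewrite mul1r.
move=> /le_trans; apply; apply: ler_sum => j _.
have -> : \sum_(k < n) 1 * 1 * (kerA (j + k) x x - kerA (j + k).+1 x x) =
    kerA j x x - kerA (j + n) x x.
  elim: n {j uT} (j : nat) => [|m IH] j; first by rewrite big_ord0 addn0 subrr.
  rewrite big_ord_recr/= -[Pop E A _ x]/(kerA (j + m).+1 x x) IH !mul1r addnS; ring.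
by rewrite gerBl; exact: ker_ge0.
Qed.

(** The path inequality along a path that ends outside [S], where the Green function vanishes. *)
Lemma sqr_gre_le n x y p : x \in S -> path E y p -> last y p \notin S ->
  gre n x y ^+ 2 <= (size p)%:R * gre n x x.
Proof.
move=> xS yp pS; have := path_dirichlet Esub (dirichlet_gre n xS) yp.
by rewrite (gre_out _ xS pS) subr0.
Qed.

Lemma gre_diag_le n x p : x \in S -> path E x p -> last x p \notin S ->
  gre n x x <= (size p)%:R.
Proof.
move=> xS xp pS; have := sqr_gre_le n xS xp pS; have := gre_ge0 n x x.
rewrite le_eqVlt => /orP[/eqP<-//|g0].
by rewrite expr2 ler_pM2r.
Qed.

Lemma gre_le n x y p q c : x \in S -> path E x p -> last x p \notin S ->
  path E y q -> last y q \notin S -> 0 <= c -> (size q)%:R * (size p)%:R <= c ^+ 2 ->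
  gre n x y <= c.
Proof.
move=> xS xp pS yq qS c0 pqc.
rewrite -(@ler_pXn2r _ 2)// ?nnegrE ?gre_ge0//; apply: le_trans pqc.
apply: (le_trans (sqr_gre_le n xS yq qS)); rewrite ler_wpM2l//.
exact: gre_diag_le.
Qed.

Definition Gre x y : R := limn (fun n => gre n x y).

Lemma cvg_gre x y : x \in S -> (fun n => gre n x y) @ \oo --> Gre x y.
Proof.
move=> xS; have [yS|yS] := boolP (y \in S); last first.
  apply/cvg_ex; exists 0; rewrite (_ : (fun n => _) = cst 0); first exact: cvg_cst.
  by apply/funext => n; exact: gre_out.
have [p [xp pS]] := exitS xS; have [q [yq qS]] := exitS yS.
apply: nondecreasing_is_cvgn.
  apply/nondecreasing_seqP => n; rewrite /gre big_ord_recr/= lerDl.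
  exact: ker_ge0.
(* Since [u <= (1 + u) ^ 2] for [u >= 0], this bound avoids a square root. *)
exists (1 + (size q)%:R * (size p)%:R) => _ [n _ <-].
apply: (gre_le _ xS xp pS yq qS); first by rewrite addr_ge0.
by have : 0 <= (size q)%:R * (size p)%:R :> R by []; nra.
Qed.

Lemma cvg_ker0 x y : x \in S -> (fun n => kerA n x y) @ \oo --> (0 : R).
Proof.
move=> xS; apply: cvg_series_cvg_0; apply/cvg_ex; exists (Gre x y).
rewrite (_ : series _ = (fun n => gre n x y)); first exact: cvg_gre.
by apply/funext => n; rewrite /series/= big_mkord.
Qed.

Lemma gre_le_Gre n x y : x \in S -> gre n x y <= Gre x y.
Proof.
move=> xS; apply: (@nondecreasing_cvgn_le _ (fun n => gre n x y)).
  apply/nondecreasing_seqP => k; rewrite /gre big_ord_recr/= lerDl.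
  exact: ker_ge0.
by apply/cvg_ex; exists (Gre x y); exact: cvg_gre.
Qed.

Lemma Gre_sym x y : x \in S -> y \in S -> Gre x y = Gre y x.
Proof.
by move=> xS yS; congr (limn _); apply/funext => n; exact: gre_sym.
Qed.

Lemma Gre_diag_gt0 x : x \in S -> 0 < Gre x x.
Proof.
move=> xS; apply: lt_le_trans (gre_le_Gre 1 x xS).
rewrite /gre big_ord1 /kerA /ker/= /dlt eqxx mul1r invr_gt0.
exact/mu_gt0/SV.
Qed.

Lemma dirichlet_Gre x : x \in S -> dirichlet_le E (Gre x) (Gre x x).
Proof.
move=> xS; apply: (@lim_dirichlet_le _ _ _ (fun n => gre n x) (fun n => gre n x x)).
- by move=> y; exact: cvg_gre.
- exact: cvg_gre.
- by move=> n; exact: dirichlet_gre.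
Qed.

Lemma sum_pst_cvg x : x \in S ->
  (fun n => \sum_(k < n) pst k x) @ \oo --> \sum_(y <- S) mu y * Gre x y.
Proof.
move=> xS; rewrite (_ : (fun n => _) = (fun n => \sum_(y <- S) mu y * gre n x y)).
  apply: cvg_big => [|y _]; first exact: add_continuous.
  by apply: cvgM; [exact: cvg_cst|exact: cvg_gre].
by apply/funext => n; exact: sum_pst.
Qed.

(** [S] with its outer boundary, as Green's formula requires for functions supported in [S]. *)
Let T := undup (S ++ flatten [seq nbrs E y | y <- S]).

(** Reproducing property: on [S] the Laplacian of [gre n x] telescopes to [mu] times
    [dlt x - kerA n x], and the last kernel tends to 0 as the term of a convergent series. *)
Lemma energy_Gre f x : x \in S -> supp_in (mem S) f -> energy E T f (Gre x) = f x.
Proof.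
move=> xS fS; have uT : uniq T by exact: undup_uniq.
have ST y : y \in S -> y \in T by move=> yS; rewrite mem_undup mem_cat yS.
have c1 : (fun n => energy E T f (gre n x)) @ \oo --> energy E T f (Gre x).
  apply: cvgM; first exact: cvg_cst.
  apply: cvg_big => [|y _]; first exact: add_continuous.
  apply: cvg_big => [|z _]; first exact: add_continuous.
  apply: cvgM; first exact: cvg_cst.
  by apply: cvgM; [exact: cvg_cst|apply: cvgB; exact: cvg_gre].
have c2 : (fun n => f x - ip E T f (kerA n x)) @ \oo --> f x.
  rewrite -[X in _ --> X]subr0; apply: cvgB; first exact: cvg_cst.
  rewrite -[X in _ --> X](_ : \sum_(y <- T) f y * 0 * mu y = 0); last first.
    by rewrite big1// => y _; rewrite mulr0 mul0r.
  apply: cvg_big => [|y _]; first exact: add_continuous.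
  apply: cvgM; last exact: cvg_cst.
  by apply: cvgM; [exact: cvg_cst|exact: cvg_ker0].
rewrite (_ : (fun n => energy E T f (gre n x)) = (fun n => f x - ip E T f (kerA n x))) in c1.
  exact: (cvg_unique _ c1 c2).
apply/funext => n; rewrite (green Esub) => //; last first.
  move=> y _ /fS yS z zy; rewrite mem_undup mem_cat; apply/orP; right.
  by apply/flatten_mapP; exists y.
rewrite -[in RHS](ip_dlt mu_gt0 f uT (SV xS) (ST _ xS)).
rewrite /ip -sumrB; apply: eq_bigr => y _.
have [->|fy] := eqVneq (f y) 0; first by rewrite !(mul0r, mulr0) subrr.
rewrite /lap; have -> : \sum_(z <- nbrs E y) gre n x z = Pop E A (gre n x) y * mu y.
  by rewrite mu_Pop /A (fS _ fy : y \in S) mul1r.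
rewrite /gre Pop_sum.
have : \sum_(k < n) kerA k x y - \sum_(k < n) Pop E A (kerA k x) y = dlt R E x y - kerA n x y.
  rewrite -sumrB; elim: n => [|m IH]; first by rewrite big_ord0 subrr.
  by rewrite big_ord_recr/= IH; ring.
move=> /(congr1 (fun u => u * (f y * mu y))) h.
transitivity ((\sum_(k < n) kerA k x y - \sum_(k < n) Pop E A (kerA k x) y) * (f y * mu y)).
  by rewrite -/mu; ring.
by rewrite h -/mu; ring.
Qed.

(* Dirichlet principle: expand [0 <= energy (f - Gre x / Gre x x)]. *)
Lemma Gre_lower f w x : x \in S -> supp_in (mem S) f -> f x = 1 -> dirichlet_le E f w ->
  1 <= w * Gre x x.
Proof.
move=> xS fS fx fw.
have uT : uniq T by exact: undup_uniq.
have Efw := fw T uT; have EG := dirichlet_Gre xS uT.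
have g0 := Gre_diag_gt0 xS; set g := Gre x x in EG g0 *.
have := energy_ge0 E T (fun y => f y - g^-1 * Gre x y).
have -> : energy E T (fun y => f y - g^-1 * Gre x y) (fun y => f y - g^-1 * Gre x y) =
    energy E T f f - 2 * g^-1 * energy E T f (Gre x) + g^-1 ^+ 2 * energy E T (Gre x) (Gre x).
  rewrite /energy; set a := 2^-1; set s1 := \sum_(_ <- _) _; set s2 := \sum_(_ <- _) _.
  set s3 := \sum_(_ <- _) _; set s4 := \sum_(_ <- _) _.
  suff -> : s1 = s2 - 2 * g^-1 * s3 + g^-1 ^+ 2 * s4 by ring.
  rewrite /s1 /s2 /s3 /s4 !mulr_sumr -sumrB -big_split/=; apply: eq_bigr => y _.
  rewrite !mulr_sumr -sumrB -big_split/=; apply: eq_bigr => z _; ring.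
rewrite energy_Gre// fx mulr1 => h.
have h2 : g^-1 ^+ 2 * energy E T (Gre x) (Gre x) <= g^-1.
  by rewrite (le_trans (ler_wpM2l (sqr_ge0 _) EG))// expr2 -mulrA mulVf ?mulr1// gt_eqF.
have h3 : g^-1 <= w by lra.
by rewrite -ler_pdivrMr// mul1r.
Qed.

(** The inequality [u <= n + U * pst n x] is averaged over a Poisson number [n] of jumps, whose mean
    is [t]. *)
Lemma Po_pst_lower U u t x : 0 <= t -> x \in S ->
  (forall z k, z \in S -> \sum_(i < k) pst i z <= U) ->
  u <= \sum_(y <- S) mu y * Gre x y -> u - t <= U * Po (fun k => pst k x) t.
Proof.
move=> t0 xS hU hu.
have key n : u <= n%:R + U * pst n x.
  apply: le_trans hu _; apply: (ler_cvg_to (sum_pst_cvg xS) (cvg_cst _)).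
  by apply: nearW => m; exact: pst_lower.
have c1 : (fun N => u * series (poisson t) N - t) @ \oo --> u - t.
  rewrite -[X in _ --> X - _]mulr1; apply: cvgB; last exact: cvg_cst.
  by apply: cvgM; [exact: cvg_cst|exact: cvg_poisson_sum].
have c2 : (fun N => U * series (fun k => poisson t k * pst k x) N) @ \oo -->
    U * Po (fun k => pst k x) t.
  by apply: cvgM; [exact: cvg_cst|exact: cvg_Po (norm_pst x)].
apply: (ler_cvg_to c1 c2); apply: nearW => N.
(* Partial sums of the Poisson mean: [k * poisson t k] is [t] times the previous weight, and the
   weights sum to at most 1. *)
have mean : \sum_(0 <= k < N) poisson t k * k%:R <= t.
  case: N => [|N]; first by rewrite big_nil.
  rewrite big_nat_recl//= mulr0 add0r.
  rewrite (eq_bigr (fun k => t * poisson t k)).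
    by rewrite -mulr_sumr -[leRHS]mulr1 ler_wpM2l// poisson_sum_le1.
  by move=> k _; rewrite mulrC poissonS.
rewrite lerBlDr /series/= !mulr_sumr.
apply: (@le_trans _ _ (\sum_(0 <= k < N) (U * (poisson t k * pst k x) + poisson t k * k%:R))).
  apply: ler_sum => k _; rewrite mulrC mulrCA -mulrDr ler_wpM2l ?poisson_ge0//.
  by rewrite addrC.
by rewrite big_split/= lerD2l.
Qed.

End KilledWalk.

(** * Potentials on the tree that separate a vertex from a cut set *)

Section TreeCut.
Variables (R : realType) (n0 : nat) (V : pred (word n0)) (E : rel (word n0)).
Hypothesis Esub : subgraph_of_B V E.
Hypothesis Econn : connected_graph V E.
Implicit Types (c u v x y z : word n0) (p q : seq (word n0)).

(** Membership of [u] in the subtree rooted at [c]: children are formed by consing a letter, so the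
    ancestors of a word are its suffixes. *)
Fixpoint descends c u : bool :=
  (u == c) || (if u is _ :: u' then descends c u' else false).

(* Edges of the tree are labelled by their endpoint farther from the root. *)
Definition child u v : word n0 := if (size u < size v)%N then v else u.

Lemma descends_size c u : descends c u -> (size c <= size u)%N.
Proof.
elim: u => [|i u IH] /=; first by rewrite orbF => /eqP <-.
by move=> /orP[/eqP<-//|/IH/leqW].
Qed.

Lemma tadj_cases u v : tadj u v ->
  (exists i, u = i :: v) \/ (exists i, v = i :: u).
Proof.
rewrite /tadj => /orP[/andP[]|/andP[]].
  by case: u => // i u _ /eqP /= ->; left; exists i.
by case: v => // i v _ /eqP /= ->; right; exists i.
Qed.

Lemma E_cases u v : E u v -> (exists i, u = i :: v) \/ (exists i, v = i :: u).
Proof. by move=> /Esub.1/and3P[_ _]; exact: tadj_cases. Qed.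

Lemma descends_edge c u v : E u v -> descends c u (+) descends c v = (c == child u v).
Proof.
have key i w : descends c (i :: w) (+) descends c w = (c == i :: w).
  rewrite /= eq_sym; have [->|_] /= := eqVneq c (i :: w); last by rewrite addbb.
  by apply/negP => /descends_size; rewrite /= ltnn.
move=> /E_cases[] [i ->]; rewrite /child /=.
  by rewrite ltnNge leqnSn/=; exact: key.
by rewrite ltnSn addbC; exact: key.
Qed.

Lemma child_cases u v c : E u v -> child u v = c ->
  (u = c /\ v = behead c) \/ (u = behead c /\ v = c).
Proof.
move=> /E_cases[] [i ->]; rewrite /child /=.
  by rewrite ltnNge leqnSn/= => <-; left.
by rewrite ltnSn => <-; right.
Qed.

Fixpoint crossed x p : seq (word n0) :=
  if p is y :: q then child x y :: crossed y q else [::].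

Lemma size_crossed x p : size (crossed x p) = size p.
Proof. by elim: p x => //= y q IH x; rewrite IH. Qed.

Lemma crossed_cat x p q : crossed x (p ++ q) = crossed x p ++ crossed (last x p) q.
Proof. by elim: p x => //= y p IH x; rewrite IH. Qed.

Lemma crossed_mem x p c : c \in crossed x p -> c \in x :: p.
Proof.
elim: p x => //= y q IH x; rewrite inE => /orP[/eqP->|/IH h].
  by rewrite /child; case: ifP; rewrite !inE eqxx ?orbT.
by rewrite inE h orbT.
Qed.

(** Each crossing of the edge above [c] toggles membership in the subtree rooted at [c]. *)
Lemma crossed_parity c x p : path E x p ->
  descends c x (+) descends c (last x p) = odd (count_mem c (crossed x p)).
Proof.
elim: p x => [|y q IH] x /=; first by rewrite addbb.
move=> /andP[xy yq]; rewrite oddD -IH//= oddb (eq_sym _ c) -(descends_edge c xy).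
by rewrite -addbA (addbA (descends c y)) addbb addFb.
Qed.

(** A step up is labelled by the vertex it leaves, which is not visited again. The label of a step
    down to [y] could recur only by an immediate return to the parent of [y], the vertex just
    left. *)
Lemma uniq_crossed x p : path E x p -> uniq (x :: p) -> uniq (crossed x p).
Proof.
elim: p x => // y q IH x /= /andP[xy yq] /andP[xyq yqu]; rewrite IH// andbT.
have [e|[i e]] := E_cases xy.
  have -> : child x y = x by case: e => i ->; rewrite /child ltnNge leqnSn.
  by apply: contra xyq => /crossed_mem.
have -> : child x y = y by rewrite e /child ltnSn.
case: q yq xyq yqu {IH} => // z q /= /andP[yz _] xyq yqu.
rewrite inE negb_or; apply/andP; split; last first.
  by apply/negP => /crossed_mem h; move: yqu; rewrite h.
apply/eqP => h; have [[j e']|[j e']] := E_cases yz.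
  by move: e; rewrite e' => -[_ zx]; move: xyq; rewrite zx !inE eqxx orbT.
move: h; rewrite e' /child ltnSn => /(congr1 size)/= /eqP.
by rewrite -[X in X == _]addn0 -addn1 eqn_add2l.
Qed.

(** Without repetition parity becomes membership. Hence the edges of a self-avoiding path depend on
    its endpoints only. *)
Lemma mem_crossed c x p : path E x p -> uniq (x :: p) ->
  (c \in crossed x p) = descends c x (+) descends c (last x p).
Proof.
move=> xp up; rewrite crossed_parity// count_uniq_mem ?uniq_crossed//.
by case: (c \in _).
Qed.

Section Potential.
Variables (x : word n0) (K : seq (word n0)).
Hypotheses (uK : uniq K) (K0 : (0 < size K)%N).

(* For K the geodesic from x to z, this is the potential that decreases
   linearly from 1 at x to 0 at z and is constant on the branches off K. *)
Definition pot y : R :=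
  1 - (\sum_(c <- K) (descends c x (+) descends c y)%:R) / (size K)%:R.

Lemma pot_center : pot x = 1.
Proof. by rewrite /pot big1 ?mul0r ?subr0// => c _; rewrite addbb. Qed.

Lemma sizeK_gt0 : 0 < (size K)%:R :> R. Proof. by rewrite ltr0n. Qed.

Lemma pot_ge0 y : 0 <= pot y.
Proof.
rewrite /pot subr_ge0 ler_pdivrMr ?sizeK_gt0// mul1r.
rewrite -sum1_size natr_sum; apply: ler_sum => c _.
by rewrite ler_nat leq_b1.
Qed.

Lemma pot_eq0 y : {in K, forall c, descends c x (+) descends c y} -> pot y = 0.
Proof.
move=> h; rewrite /pot.
rewrite (_ : \sum_(c <- K) _ = (size K)%:R) ?divff ?subrr// ?gt_eqF ?sizeK_gt0//.
by rewrite -sum1_size natr_sum; apply: eq_big_seq => c /h ->.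
Qed.

(** Crossing an edge alters only the summand of its own label, by at most 1. *)
Lemma pot_edge u v : E u v ->
  (pot u - pot v) ^+ 2 <= (child u v \in K)%:R / (size K)%:R ^+ 2.
Proof.
move=> uv; have D0 := sizeK_gt0; set D := (size K)%:R in D0 *.
have -> : pot u - pot v = (\sum_(c <- K) ((descends c x (+) descends c v)%:R
    - (descends c x (+) descends c u)%:R)) / D.
  by rewrite /pot sumrB -/D; field; rewrite gt_eqF.
rewrite expr_div_n ler_wpM2r ?invr_ge0 ?exprn_ge0 ?(ltW D0)//.
pose w c : R := (descends c x (+) descends c v)%:R - (descends c x (+) descends c u)%:R.
have w0 c : c != child u v -> w c = 0.
  rewrite -(descends_edge c uv) /w.
  by case: (descends c u); case: (descends c v) => //; rewrite subrr.
have [cK|cK] := boolP (child u v \in K).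
  rewrite (bigD1_seq (child u v))//= -/(w _) [X in _ + X]big1 ?addr0 => [|c /w0//].
  rewrite /w; do 2!case: (_ (+) _) => /=; lra.
rewrite big1_seq ?expr0n// => c /andP[_ cK']; apply: w0.
by apply: contraNneq cK => <-.
Qed.

Lemma dirichlet_pot : dirichlet_le E pot (size K)%:R^-1.
Proof.
move=> S uS; have D0 := sizeK_gt0; rewrite /energy; set D := (size K)%:R in D0 *.
rewrite -ler_pdivlMl ?invr_gt0// invrK.
have one u : \sum_(y <- S) (y == u)%:R <= 1 :> R.
  have [uin|uin] := boolP (u \in S).
    by rewrite (bigD1_seq u)//= eqxx big1 ?addr0// => y /negPf->.
  by rewrite big1_seq// => y /andP[_ yS]; case: eqP => // yu; rewrite -yu yS in uin.
(* A label belongs to a single edge of the tree, which is met in two orientations. *)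
have two c : \sum_(u <- S) \sum_(v <- S) (E u v)%:R * (child u v == c)%:R <= 2 :> R.
  apply: (@le_trans _ _ (\sum_(u <- S) \sum_(v <- S)
      ((u == c)%:R * (v == behead c)%:R + (u == behead c)%:R * (v == c)%:R))).
    apply: ler_sum => u _; apply: ler_sum => v _.
    case uv : (E u v); last by rewrite mul0r addr_ge0// mulr_ge0.
    rewrite mul1r; case: eqP => [cE|_]; last by rewrite addr_ge0// mulr_ge0.
    have [[-> ->]|[-> ->]] := child_cases uv cE; rewrite !eqxx mul1r.
      by rewrite lerDl mulr_ge0.
    by rewrite lerDr mulr_ge0.
  under eq_bigr do rewrite big_split/= -!mulr_sumr.
  rewrite big_split/= -!mulr_suml -[leRHS]/(1 + 1) lerD//.
    by rewrite -[leRHS]mulr1 ler_pM// sumr_ge0.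
  by rewrite -[leRHS]mulr1 ler_pM// sumr_ge0.
apply: (@le_trans _ _ (D ^- 2 * \sum_(c <- K) \sum_(u <- S) \sum_(v <- S)
     (E u v)%:R * (child u v == c)%:R)).
  rewrite [X in _ <= _ * X]exchange_big/= mulr_sumr; apply: ler_sum => u _.
  rewrite [X in _ <= _ * X]exchange_big/= mulr_sumr; apply: ler_sum => v _.
  rewrite -mulr_sumr; case uv : (E u v); last by rewrite !mul0r mulr0.
  rewrite !mul1r -expr2; apply: (le_trans (pot_edge uv)); rewrite mulrC.
  rewrite ler_wpM2l ?invr_ge0 ?exprn_ge0 ?(ltW D0)//.
  have [cK|_] := boolP (child u v \in K); last by rewrite sumr_ge0.
  by rewrite (bigD1_seq (child u v))//= eqxx lerDl sumr_ge0.
rewrite mulrC ler_pdivrMr ?exprn_gt0//.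
have -> : 2 * D^-1 * D ^+ 2 = \sum_(c <- K) 2.
  rewrite big_const_seq count_predT iter_addr_0 -[RHS]mulr_natr -/D.
  by field; rewrite gt_eqF.
exact: ler_sum.
Qed.

End Potential.

Lemma dirichlet_min (f g : word n0 -> R) W W' : dirichlet_le E f W -> dirichlet_le E g W' ->
  dirichlet_le E (fun y => Num.min (f y) (g y)) (W + W').
Proof.
move=> fW gW S uS; apply: le_trans (lerD (fW S uS) (gW S uS)).
rewrite /energy -mulrDr ler_wpM2l ?invr_ge0// -big_split/=; apply: ler_sum => u _.
rewrite -big_split/=; apply: ler_sum => v _; rewrite -mulrDr ler_wpM2l//.
move: (f u) (f v) (g u) (g v) => a a' b b'.
(* If the two minima come from different functions, their difference [d] lies between the
   differences [l] and [h] of these functions. *)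
have mix d l h : l <= d -> d <= h -> d * d <= l * l + h * h :> R.
  by move=> ld dh; have [d0|d0] := leP 0 d; nra.
rewrite /Order.min; case: ltP => ab; case: ltP => ab'.
- by rewrite lerDl -expr2 sqr_ge0.
- by apply: mix; lra.
- by rewrite [leRHS]addrC; apply: mix; lra.
- by rewrite lerDr -expr2 sqr_ge0.
Qed.

(** The minimum of one linear potential per point of [s]. Each is carried by a self-avoiding path of
    length at least [rho], so it has energy at most [1 / rho], and it vanishes beyond its point. *)
Lemma cut_potential x s (rho : R) : 0 < rho -> V x ->
  (forall z, z \in s -> V z /\ rho <= (gdist E x z)%:R) ->
  exists f : word n0 -> R, [/\ f x = 1, forall y, 0 <= f y,
    forall y, ~~ V y -> f y = 0, dirichlet_le E f ((size s)%:R / rho) &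
    forall p z, path E x p -> uniq (x :: p) -> z \in s -> z \in x :: p -> f (last x p) = 0].
Proof.
move=> rho0 Vx; elim: s => [|z s IH] sP.
  exists (fun y => (V y)%:R); split => //.
  - by rewrite Vx.
  - by move=> y /negPf ->.
  - move=> S _; rewrite mul0r /energy big1 ?mulr0// => u _; rewrite big1// => v _.
    case uv : (E u v); last by rewrite mul0r.
    by have [-> ->] := E_V Esub uv; rewrite subrr !mul0r mulr0.
have [|f [fx f0 fV fW fcut]] := IH.
  by move=> z' z's; apply: sP; rewrite inE z's orbT.
have [Vz rz] : V z /\ rho <= (gdist E x z)%:R by apply: sP; rewrite mem_head.
have [p0 [xp0 p0z]] := Econn Vx Vz.
have [p1 [xp1 up1 p1z]] : exists p1, [/\ path E x p1, uniq (x :: p1) & last x p1 = z].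
  by move: p0z; case/shortenP: xp0 => q xq uq _ qz; exists q.
pose K := crossed x p1.
have uK : uniq K by exact: uniq_crossed.
have rK : rho <= (size K)%:R.
  by rewrite size_crossed (le_trans rz)// ler_nat -p1z gdist_le.
have K0 : (0 < size K)%N by rewrite -(ltr0n R) (lt_le_trans rho0).
exists (fun y => Num.min (pot x K y) (f y)); split.
- by rewrite pot_center fx /Order.min ltxx.
- by move=> y; rewrite le_min pot_ge0// f0.
- move=> y Vy; rewrite fV// /Order.min; case: ltP => // h; apply/eqP.
  by rewrite eq_le ltW//= pot_ge0.
- rewrite /= -[(size s).+1]add1n natrD mulrDl mul1r.
  apply: dirichlet_min fW => S uS; apply: (le_trans (dirichlet_pot x uK K0 uS)).
  by rewrite lef_pV2// posrE// ltr0n.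
- move=> p z' xp up; rewrite inE => /orP[/eqP->|z's] zp; last first.
    rewrite (fcut _ z')// /Order.min; case: ltP => // h; apply/eqP.
    by rewrite eq_le ltW//= pot_ge0.
  (* A self-avoiding path through [z] uses every edge of [K] before [z] and none of them later, so
     all of them separate its endpoint from [x]. *)
  suff -> : pot x K (last x p) = 0.
    rewrite /Order.min; case: ltP => // h; apply/eqP.
    by rewrite eq_le h f0.
  apply: pot_eq0 => // c; rewrite /K mem_crossed// p1z => h.
  case/splitPl: zp xp up => q1 q2 q1z xq up.
  have xq1 : path E x q1 by move: xq; rewrite cat_path => /andP[].
  rewrite -mem_crossed// crossed_cat mem_cat mem_crossed// ?q1z ?h//.
  by move: up; rewrite -cat_cons cat_uniq => /andP[].
Qed.

End TreeCut.

(** * Balls as lists, and paths leaving them *)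

Section Balls.
Variables (R : realType) (n0 : nat) (V : pred (word n0)) (E : rel (word n0)).
Hypothesis Esub : subgraph_of_B V E.
Hypothesis Econn : connected_graph V E.
Hypothesis Vinf : infinite_graph V.
Implicit Types (x y z : word n0) (p q : seq (word n0)).

Lemma path_V x p : V x -> path E x p -> V (last x p).
Proof.
by elim: p x => //= y p IH x Vx /andP[/(E_V Esub)[_ Vy]]; exact: IH.
Qed.

Lemma bseq_path x n y :
  y \in bseq E x n <-> exists p, [/\ path E x p, last x p = y & (size p <= n)%N].
Proof.
elim: n y => [|n IH] y.
  rewrite mem_seq1; split => [/eqP ->|[p [_ <-]]]; first by exists [::].
  by rewrite leqn0 size_eq0 => /eqP ->.
split.
  rewrite /= mem_undup mem_cat => /orP[/IH[p [xp py pn]]|].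
    by exists p; split => //; exact: leqW.
  case/flatten_mapP => z zn; have [p [xp pz pn]] := (IH z).1 zn; rewrite (mem_nbrs Esub) => zy.
  by exists (rcons p y); rewrite rcons_path xp pz zy last_rcons size_rcons.
case=> p [+ + +]; case/lastP: p => [|p z].
  by move=> _ <- _; exact: bseq_center.
rewrite rcons_path last_rcons size_rcons ltnS => /andP[xp pz] <- pn.
have pxn : last x p \in bseq E x n by apply/IH; exists p.
exact: (bseq_nbrs Esub pxn pz).
Qed.

Lemma bseq_V x n : V x -> {subset bseq E x n <= V}.
Proof. by move=> Vx y /bseq_path[p [xp <- _]]; exact: path_V. Qed.

Lemma bseq_gdist x n y : V x -> (y \in bseq E x n) = V y && (gdist E x y <= n)%N.
Proof.
move=> Vx; apply/idP/andP => [yn|[Vy yn]].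
  split; first exact: (bseq_V Vx yn).
  by case/bseq_path: yn => p [xp <- pn]; apply: leq_trans pn; exact: gdist_le.
apply/bseq_path; have [p [xp py pd]] := gdist_path Econn Vx Vy.
by exists p; rewrite pd.
Qed.

Lemma gball_bseq x (r : R) : V x -> 0 <= r ->
  gball V E x r = [set` bseq E x (Num.truncn r)].
Proof.
move=> Vx r0; apply/seteqP; split => y /=.
  by move=> [Vy yr]; rewrite bseq_gdist// Vy truncn_ge_nat.
by rewrite bseq_gdist// => /andP[Vy]; rewrite truncn_ge_nat.
Qed.

Lemma mem_gball x (r : R) y : V x -> 0 <= r ->
  gball V E x r y <-> y \in bseq E x (Num.truncn r).
Proof. by move=> Vx r0; rewrite gball_bseq. Qed.

Lemma vol_bseq x (r : R) : V x -> 0 <= r ->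
  vol V E x r = \sum_(y <- bseq E x (Num.truncn r)) mu R E y.
Proof.
by move=> Vx r0; rewrite /vol /muset gball_bseq// -fsbig_seq// bseq_uniq.
Qed.

Lemma exists_far x n : exists y, V y /\ y \notin bseq E x n.
Proof.
apply: contrapT => h; apply: Vinf.
apply: (@sub_finite_set _ _ [set` bseq E x n]); last exact: finite_seq.
move=> y /= Vy; apply: contrapT => /negP yn; apply: h; by exists y.
Qed.

Lemma mu_gt0 x : V x -> 0 < mu R E x.
Proof.
move=> Vx; have [y [Vy yx]] := exists_far x 0.
rewrite mem_seq1 in yx; have [p [xp py]] := Econn Vx Vy.
case: p xp py => [_ /= xy|z p /= /andP[xz _] _]; first by rewrite xy eqxx in yx.
rewrite /mu ltr0n lt0n size_eq0; apply/eqP => e.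
by have := mem_nbrs Esub x z; rewrite e xz.
Qed.

Lemma rev_path_E x p : path E x p ->
  exists q, [/\ path E (last x p) q, last (last x p) q = x & size q = size p].
Proof.
move=> xp; exists (rev (belast x p)); split.
- by rewrite rev_path (eq_path (e' := E)) // => u v; rewrite (E_sym Esub).
- by case: p {xp} => //= y p; rewrite rev_cons last_rcons.
- by rewrite size_rev size_belast.
Qed.

Lemma gdist_sym x y : V x -> V y -> gdist E x y = gdist E y x.
Proof.
have le u v : V u -> V v -> (gdist E v u <= gdist E u v)%N.
  move=> Vu Vv; have [p [up pv <-]] := gdist_path Econn Vu Vv.
  have [q [vq qu <-]] := rev_path_E up; rewrite pv in vq qu.
  by rewrite -{1}qu; exact: gdist_le.
by move=> Vx Vy; apply/eqP; rewrite eqn_leq !le.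
Qed.

(** A geodesic to a far vertex is cut after [n.+1] steps; were the cut point within distance [n] of
    [x], the geodesic could be shortened. *)
Lemma exit_path x n : V x ->
  exists p, [/\ path E x p, last x p \notin bseq E x n & size p = n.+1].
Proof.
move=> Vx; have [z [Vz zn]] := exists_far x n.
have [p [xp pz pd]] := gdist_path Econn Vx Vz.
have np : (n < size p)%N.
  by rewrite pd ltnNge; apply: contra zn; rewrite bseq_gdist// Vz.
move: xp pz; rewrite -(cat_take_drop n.+1 p) cat_path last_cat => /andP[xt td] dz.
exists (take n.+1 p); split => //; last by rewrite size_takel.
apply/negP => /bseq_path[q [xq qt qn]].
have := @gdist_le _ E x (q ++ drop n.+1 p).
rewrite cat_path xq qt td last_cat qt dz => /(_ isT).
rewrite size_cat size_drop -pd leqNgt; apply/negP; rewrite negbK.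
by rewrite -{2}(subnK np) addnC ltn_add2l ltnS.
Qed.

(** A geodesic back to the centre is followed by a shortest way out of the ball. *)
Lemma exit_path_from x n y : V x -> y \in bseq E x n ->
  exists p, [/\ path E y p, last y p \notin bseq E x n &
                (size p = gdist E x y + n.+1)%N].
Proof.
move=> Vx yn; have Vy := bseq_V Vx yn.
have [q [xq qn qs]] := exit_path n Vx.
have [p [yp px pd]] := gdist_path Econn Vy Vx.
exists (p ++ q); rewrite cat_path last_cat yp px; split => //.
by rewrite size_cat pd qs gdist_sym.
Qed.

End Balls.

Lemma ltr_sqr_pos (R : realDomainType) (a b : R) : 0 <= a -> a < b -> a ^+ 2 < b ^+ 2.
Proof. by move=> a0 ab; nra. Qed.

(** * Exit times and Green function of a good ball *)

Section GoodBall.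
Variables (R : realType) (n0 : nat) (V : pred (word n0)) (E : rel (word n0)).
Hypothesis Esub : subgraph_of_B V E.
Hypothesis Econn : connected_graph V E.
Hypothesis Vinf : infinite_graph V.
Variables (x0 : word n0) (r lam : R).
Hypotheses (Vx0 : V x0) (r1 : 1 <= r) (lam1 : 1 <= lam) (hgood : good V E x0 r lam).
Implicit Types (x y z : word n0) (t : R).

Let mu := mu R E.
Let mu_gt0 x : V x -> 0 < mu x. Proof. exact: mu_gt0. Qed.
Let N := Num.truncn r.
Let S := bseq E x0 N.
Let Gr := Gre R E S.
Let uS : uniq S. Proof. exact: bseq_uniq. Qed.
Let SV : {subset S <= V}. Proof. exact: bseq_V. Qed.
Let r0 : 0 < r. Proof. exact: lt_le_trans r1. Qed.
Let lam0 : 0 < lam. Proof. exact: lt_le_trans lam1. Qed.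

Let exitS y : y \in S -> exists p, path E y p /\ last y p \notin S.
Proof.
move=> yS; have [p [yp pS _]] := exit_path_from Esub Econn Vinf Vx0 yS.
by exists p.
Qed.

Lemma good_cut : exists s, cut_ok V E x0 r s /\ (size s)%:R <= lam / 64.
Proof.
have [_ _ + _ _] := hgood; rewrite /Mcut; case: pselect => [h|_]; last by rewrite leye_eq.
case: ex_minnP => m /asboolP[s [<- sc]] _; rewrite lee_fin => ml.
by exists s.
Qed.

Lemma lam_ge64 : 64 <= lam.
Proof.
have [s [[_ sc] sl]] := good_cut.
have [p [xp pS _]] := exit_path Esub Econn Vinf N Vx0.
have [z zs _] : exists2 z, z \in s & z \in x0 :: p.
  apply: sc => //; first exact: (path_V Esub).
  by move/(mem_gball Esub Econn _ Vx0 (ltW r0)); rewrite (negPf pS).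
have : 1 <= (size s)%:R :> R by rewrite ler1n; case: s zs {sc sl}.
lra.
Qed.

(** A cut point lies at a positive integer distance, at most [3 r / 4]. This excludes radii so close
    to 1 that rounding would spoil the constant 2 in the upper bound for exit times. *)
Lemma r_ge43 : 4 / 3 <= r.
Proof.
have [s [[sd sc] sl]] := good_cut.
have [p [xp pS _]] := exit_path Esub Econn Vinf N Vx0.
have [z zs _] : exists2 z, z \in s & z \in x0 :: p.
  apply: sc => //; first exact: (path_V Esub).
  by move/(mem_gball Esub Econn _ Vx0 (ltW r0)); rewrite (negPf pS).
have [_ [d1 d2]] := sd z zs.
have : 1 <= (gdist E x0 z)%:R :> R.
  by rewrite ler1n lt0n; apply/eqP => d0; rewrite d0 in d1; have := r0; lra.
lra.
Qed.

Let N_le : N%:R <= r. Proof. by rewrite /N truncn_le// ltW. Qed.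

Lemma mem_S x (rho : R) : 0 <= rho -> rho <= r -> gball V E x0 rho x ->
  [/\ x \in S, V x & (gdist E x0 x)%:R <= rho].
Proof.
move=> rho0 rhor [Vx dx]; split => //.
by rewrite /S (bseq_gdist Esub Econn)// Vx /N truncn_ge_nat ?(le_trans dx)// ltW.
Qed.

Lemma sum_mu_S : \sum_(y <- S) mu y <= r ^+ 2 * lam.
Proof.
have [_ [_ +] _ _ _] := hgood.
by rewrite (vol_bseq Esub Econn)// ltW.
Qed.

(** The square of [c] dominates the product of the lengths of exit paths from [x] and from any point
    of the ball, so [c] bounds the truncated Green function; the other factor is the volume. *)
Lemma sum_pst_le n x c : x \in S -> 0 <= c ->
  (N + N.+1)%:R * (gdist E x0 x + N.+1)%:R <= c ^+ 2 ->
  \sum_(k < n) pst R E S k x <= c * (r ^+ 2 * lam).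
Proof.
move=> xS c0 hc; rewrite (sum_pst Esub mu_gt0 uS SV)//.
apply: (@le_trans _ _ (\sum_(y <- S) mu y * c)).
  rewrite big_seq [leRHS]big_seq; apply: ler_sum => y yS.
  rewrite ler_wpM2l ?mu_ge0//.
  have [p [xp pS ps]] := exit_path_from Esub Econn Vinf Vx0 xS.
  have [q [yq qS qs]] := exit_path_from Esub Econn Vinf Vx0 yS.
  apply: (gre_le Esub mu_gt0 SV n xS xp pS yq qS c0).
  rewrite ps qs; apply: le_trans hc; rewrite ler_wpM2r// ler_nat leq_add2r.
  by move: yS; rewrite /S (bseq_gdist Esub Econn)// => /andP[].
by rewrite -mulr_suml mulrC ler_wpM2l// sum_mu_S.
Qed.

Lemma sum_pst_center n x : gball V E x0 (r / lam) x ->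
  \sum_(k < n) pst R E S k x <= 2 * lam * r ^+ 3.
Proof.
move=> xB; have l64 := lam_ge64; have r43 := r_ge43; have Nr := N_le.
have rl : r / lam <= r / 64 by rewrite ler_pM2l// lef_pV2 ?posrE//; lra.
have rl0 : 0 < r / lam by rewrite divr_gt0.
have rlr : r / lam <= r by rewrite ler_pdivrMr// ler_peMr// ltW.
have [xS Vx dx] := mem_S (ltW rl0) rlr xB.
have -> : 2 * lam * r ^+ 3 = (2 * r) * (r ^+ 2 * lam) by ring.
apply: sum_pst_le => //; first by rewrite mulr_ge0// ltW.
have dx' := le_trans dx rl.
(* For [r < 2] rounding gives [N <= 1] and [d(x0, x) = 0], so the product is at most 6, below
   [4 r ^ 2] because [r >= 4 / 3]. For [r >= 2] the bound [d(x0, x) <= r / 64] suffices. *)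
rewrite !natrD -!natr1; have [r2|r2] := ltP r 2.
  have N1 : N%:R <= 1 :> R.
    rewrite lern1 -ltnS -(ltr_nat R) (le_lt_trans Nr)//.
  have d0 : (gdist E x0 x)%:R = 0 :> R.
    apply/eqP; rewrite pnatr_eq0 -leqn0 -ltnS -(ltr_nat R) (le_lt_trans dx')//; lra.
  rewrite d0; have : 0 <= N%:R :> R by []; nra.
have : 0 <= N%:R :> R by [].
have : 0 <= (gdist E x0 x)%:R :> R by [].
move: (N%:R) (gdist E x0 x)%:R Nr dx' => n' d' Nr dx' d0 n'0.
apply: (@le_trans _ _ ((r + (r + 1)) * (r / 64 + (r + 1)))); last by nra.
by apply: ler_pM; lra.
Qed.

(** From any point of the ball there is an exit path of length at most [2 N + 1 <= 3 r]. *)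
Lemma sum_pst_all n x : x \in S -> \sum_(k < n) pst R E S k x <= 3 * lam * r ^+ 3.
Proof.
move=> xS; have Nr := N_le.
have -> : 3 * lam * r ^+ 3 = (3 * r) * (r ^+ 2 * lam) by ring.
apply: sum_pst_le => //; first by rewrite mulr_ge0// ltW.
have : (gdist E x0 x)%:R <= N%:R :> R.
  by rewrite ler_nat; move: xS; rewrite /S (bseq_gdist Esub Econn)// => /andP[].
have : 0 <= N%:R :> R by [].
have : 0 <= (gdist E x0 x)%:R :> R by [].
rewrite !natrD -!natr1.
move: (N%:R) (gdist E x0 x)%:R Nr => n' d' Nr dx' d0 n'0.
rewrite expr2; apply: ler_pM; have := r1; lra.
Qed.

Lemma Gre_center : 16 * (r / lam) <= Gr x0 x0.
Proof.
have [s [[sd sc] sl]] := good_cut.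
have rho0 : 0 < r / 4 by rewrite divr_gt0.
have [|f [fx f0 fV fW fcut]] := cut_potential Esub Econn rho0 Vx0 (s := s).
  by move=> z /sd[Vz [d1 _]].
have x0S : x0 \in S by exact: bseq_center.
(* A self-avoiding path from [x0] out of the ball meets the cut, so [f] vanishes at its endpoint. *)
have fS : supp_in (mem S) f.
  move=> y; apply: contraNT => yS /=.
  have [Vy|/fV-> //] := boolP (V y); apply/eqP.
  have [p [xp py]] := Econn Vx0 Vy.
  have [q [xq uq qy]] : exists q, [/\ path E x0 q, uniq (x0 :: q) & last x0 q = y].
    by move: py; case/shortenP: xp => q xq uq _ qy; exists q.
  rewrite -qy; have [z zs zq] : exists2 z, z \in s & z \in x0 :: q.
    apply: sc => //; rewrite qy// => /(mem_gball Esub Econn _ Vx0 (ltW r0)) yS'.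
    by rewrite /= yS' in yS.
  exact: fcut xq uq zs zq.
have h := Gre_lower Esub mu_gt0 SV exitS x0S fS fx fW.
have g0 : 0 < Gr x0 x0 by exact: (Gre_diag_gt0 Esub mu_gt0 SV exitS).
have sW : (size s)%:R / (r / 4) <= lam / 16 / r.
  rewrite ler_pdivrMr// (_ : lam / 16 / r * (r / 4) = lam / 64)//.
  by field; rewrite gt_eqF.
have : 1 <= lam / 16 / r * Gr x0 x0.
  by apply: (le_trans h); rewrite ler_wpM2r// ltW.
rewrite mulrAC ler_pdivlMr// mul1r => h'.
by rewrite mulrA ler_pdivrMr//; nra.
Qed.

(** Three uses of the path inequality over distances at most [rho = r / lam]. As
    [Gr x0 x0 >= 16 rho], the first gives [b = Gr x0 x >= 12 rho], the second [Gr x x <= 2 b], the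
    third [Gr x y >= b / 2]. *)
Lemma Gre_ball x y : gball V E x0 (r / lam) x -> gball V E x0 (r / lam) y ->
  6 * (r / lam) <= Gr x y.
Proof.
move=> xB yB; have rl0 : 0 < r / lam by rewrite divr_gt0.
have rlr : r / lam <= r by rewrite ler_pdivrMr// ler_peMr// ltW.
have [xS Vx dx] := mem_S (ltW rl0) rlr xB; have [yS Vy dy] := mem_S (ltW rl0) rlr yB.
have x0S : x0 \in S by exact: bseq_center.
have g16 := Gre_center; set rho := r / lam in rl0 dx dy g16 *.
have diff z u v : z \in S -> V u -> V v -> (gdist E u v)%:R <= rho ->
    (Gr z u - Gr z v) ^+ 2 <= rho * Gr z z.
  move=> zS Vu Vv duv.
  apply: (le_trans (dirichlet_gdist Esub Econn (dirichlet_Gre Esub mu_gt0 SV exitS zS) Vu Vv)).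
  by rewrite ler_wpM2r// ltW// (Gre_diag_gt0 Esub mu_gt0 SV exitS).
have h1 := diff x0 x0 x x0S Vx0 Vx dx.
have h2 := diff x x0 x xS Vx0 Vx dx.
have h3 := diff x x0 y xS Vx0 Vy dy.
have Gs : Gr x x0 = Gr x0 x by exact: (Gre_sym Esub mu_gt0 SV).
have gx : 0 < Gr x x by exact: (Gre_diag_gt0 Esub mu_gt0 SV exitS).
rewrite Gs in h2 h3.
move: (Gr x0 x0) (Gr x0 x) (Gr x x) (Gr x y) g16 h1 h2 h3 gx => g b gx b' g16 h1 h2 h3 gx0.
have b12 : 12 * rho <= b.
  suff : g - b <= g / 4 by lra.
  rewrite leNgt; apply/negP => h; have : (g / 4) ^+ 2 < (g - b) ^+ 2.
    by apply: ltr_sqr_pos; lra.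
  by nra.
have gx2 : gx <= 2 * b.
  rewrite leNgt; apply/negP => h; have : (gx / 2) ^+ 2 < (gx - b) ^+ 2.
    by apply: ltr_sqr_pos; lra.
  by nra.
suff : b - b' <= b / 2 by lra.
rewrite leNgt; apply/negP => h; have : (b / 2) ^+ 2 < (b - b') ^+ 2.
  by apply: ltr_sqr_pos; lra.
by nra.
Qed.

(** Only the points of [B(x0, r / lam)] are kept; in a good ball their mass is at least
    [r ^ 2 / lam ^ 4]. *)
Lemma sum_Gre_ball x : gball V E x0 (r / lam) x ->
  6 * (r ^+ 3 / lam ^+ 5) <= \sum_(y <- S) mu y * Gr x y.
Proof.
move=> xB; have rl0 : 0 < r / lam by rewrite divr_gt0.
have rlr : r / lam <= r by rewrite ler_pdivrMr// ler_peMr// ltW.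
have [xS Vx dx] := mem_S (ltW rl0) rlr xB.
pose S' := bseq E x0 (Num.truncn (r / lam)).
have G0 y : 0 <= Gr x y.
  apply: le_trans (gre_le_Gre Esub mu_gt0 SV exitS 0 y xS).
  exact: gre_ge0.
apply: (@le_trans _ _ (\sum_(y <- S') mu y * Gr x y)); last first.
  apply: ler_sum_uniq_sub; first exact: bseq_uniq.
    move=> y /(mem_gball Esub Econn _ Vx0 (ltW rl0)) yB.
    by have [] := mem_S (ltW rl0) rlr yB.
  by move=> y; rewrite mulr_ge0// mu_ge0.
apply: (@le_trans _ _ (\sum_(y <- S') mu y * (6 * (r / lam)))).
  rewrite -mulr_suml; have [_ _ _ + _] := hgood.
  rewrite (vol_bseq Esub Econn) ?(ltW rl0)// -/S' -/mu => hv.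
  have -> : 6 * (r ^+ 3 / lam ^+ 5) = (r ^+ 2 / lam ^+ 4) * (6 * (r / lam)).
    by field; rewrite gt_eqF.
  by rewrite ler_wpM2r// mulr_ge0// ltW.
rewrite big_seq [leRHS]big_seq; apply: ler_sum => y.
move=> /(mem_gball Esub Econn _ Vx0 (ltW rl0)) yB.
by rewrite ler_wpM2l ?mu_ge0// Gre_ball.
Qed.

Lemma pstay_pst k x : pstay R E (gball V E x0 r) k x = pst R E S k x.
Proof.
apply: pstay_iter => y.
by apply/asboolP/idP => /(mem_gball Esub Econn _ Vx0 (ltW r0)).
Qed.

Lemma Etau_pst x : (Etau R E (gball V E x0 r) x = \sum_(k <oo) (pst R E S k x)%:E)%E.
Proof.
rewrite -integral_Po; last by move=> k; rewrite pst_ge0 pst_le1.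
apply: eq_integral => t _; congr EFin; rewrite /surv /Po.
congr (limn (series _)); apply/funext => k.
by rewrite pstay_pst.
Qed.

Lemma Etau_bounds x : gball V E x0 (r / lam) x ->
  ((6 * r ^+ 3 / lam ^+ 5)%:E <= Etau R E (gball V E x0 r) x)%E /\
  (Etau R E (gball V E x0 r) x <= (2 * lam * r ^+ 3)%:E)%E.
Proof.
move=> xB; rewrite Etau_pst.
have rl0 : 0 < r / lam by rewrite divr_gt0.
have rlr : r / lam <= r by rewrite ler_pdivrMr// ler_peMr// ltW.
have [xS Vx dx] := mem_S (ltW rl0) rlr xB.
have c := sum_pst_cvg Esub mu_gt0 uS SV exitS xS.
have -> : (\sum_(k <oo) (pst R E S k x)%:E = (\sum_(y <- S) mu y * Gr x y)%:E)%E.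
  apply/cvg_lim => //.
  rewrite (_ : (fun n => _) = EFin \o (fun n => \sum_(k < n) pst R E S k x)).
    by apply: cvg_EFin => //; exact: nearW.
  by apply/funext => n /=; rewrite sumEFin big_mkord.
rewrite !lee_fin -mulrA sum_Gre_ball//; split => //.
apply: (ler_cvg_to c (cvg_cst _)); apply: nearW => n.
exact: sum_pst_center.
Qed.

(** * Heat kernel bounds for times in the interval [I] *)

Section Time.
Variable t : R.
Hypothesis tI : r ^+ 3 / lam ^+ 6 <= t <= r ^+ 3 / lam ^+ 5.

Let t0 : 0 < t.
Proof.
by have /andP[+ _] := tI; apply: lt_le_trans; rewrite divr_gt0 ?exprn_gt0.
Qed.

(** The cube root of [t] turns the fractional powers of [t] into integer ones. *)
Let tau := t `^ (3^-1).

Lemma tau_gt0 : 0 < tau. Proof. by rewrite powR_gt0. Qed.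

Lemma tau3 : tau ^+ 3 = t.
Proof.
by rewrite /tau -powR_mulrn ?powR_ge0// -powRrM mulVf ?powRr1 ?ltW.
Qed.

Lemma powR_tau : t `^ (- (2 / 3)) = tau ^- 2.
Proof.
by rewrite powRN /tau -powR_mulrn ?powR_ge0// -powRrM (mulrC 2).
Qed.

Lemma r_le_tau : r <= lam ^+ 2 * tau.
Proof.
have /andP[+ _] := tI; rewrite ler_pdivrMr ?exprn_gt0// -tau3 => h.
have t0' := tau_gt0.
rewrite -(@ler_pXn2r _ 3)// ?nnegrE ?(ltW r0) ?mulr_ge0 ?exprn_ge0 ?(ltW lam0) ?(ltW t0')//.
by apply: (le_trans h); rewrite exprMn -exprM mulrC.
Qed.

(** The mean exit time exceeds [t] by at least [5 r ^ 3 / lam ^ 5], and from any point of the ball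
    it is at most [3 lam r ^ 3]; so survival up to [t] has probability at least [lam ^- 6]. Squaring
    and dividing by the volume [r ^ 2 lam] gives the bound. *)
Lemma qker_diag_lower x : gball V E x0 (r / lam) x ->
  r ^- 2 / lam ^+ 13 <= qker E (t + t) x x.
Proof.
move=> xB; have rl0 : 0 < r / lam by rewrite divr_gt0.
have rlr : r / lam <= r by rewrite ler_pdivrMr// ler_peMr// ltW.
have [xS Vx dx] := mem_S (ltW rl0) rlr xB.
have U0 : 0 < 3 * lam * r ^+ 3 by rewrite !mulr_gt0// exprn_gt0.
pose P := Po (fun k => pst R E S k x) t.
have hP : 6 * (r ^+ 3 / lam ^+ 5) - t <= 3 * lam * r ^+ 3 * P.
  apply: (Po_pst_lower Esub mu_gt0 uS SV exitS (ltW t0) xS _ (sum_Gre_ball xB)).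
  by move=> z k zS; exact: sum_pst_all.
have P6 : lam ^- 6 <= P.
  have /andP[_ t5] := tI.
  rewrite -(ler_pM2l U0); apply: le_trans hP.
  have -> : 3 * lam * r ^+ 3 / lam ^+ 6 = 3 * (r ^+ 3 / lam ^+ 5) by field; rewrite gt_eqF.
  have : 0 <= r ^+ 3 / lam ^+ 5 by rewrite divr_ge0// exprn_ge0// ltW.
  by lra.
have h : P ^+ 2 <= (\sum_(y <- S) mu y) * qker E (t + t) x x.
  apply: (sqr_Po_le_qker Esub mu_gt0 uS SV Vx (ltW t0)) => k.
  by rewrite pst_ge0 (pst_le_free mu_gt0 uS SV).
have q0 : 0 <= qker E (t + t) x x.
  by apply: (qker_ge0 Esub mu_gt0) => //; rewrite addr_ge0 ?ltW.
have {}h : lam ^- 12 <= r ^+ 2 * lam * qker E (t + t) x x.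
  apply: (@le_trans _ _ (P ^+ 2)); last first.
    by apply: (le_trans h); rewrite ler_wpM2r// sum_mu_S.
  rewrite (_ : lam ^- 12 = (lam ^- 6) ^+ 2); last by rewrite -exprVn -exprVn -exprM.
  rewrite lerXn2r// ?nnegrE ?invr_ge0 ?exprn_ge0 ?(ltW lam0)//.
  by apply: le_trans P6; rewrite invr_ge0 exprn_ge0// ltW.
have rl : 0 < r ^+ 2 * lam by rewrite mulr_gt0// exprn_gt0.
rewrite -(ler_pM2l rl); apply: le_trans h.
rewrite le_eqVlt; apply/orP; left; apply/eqP.
by field; rewrite !gt_eqF.
Qed.

Lemma qker_lower x y : gball V E x0 (r / lam) x -> V y ->
  (gdist E x y)%:R <= 2^-1 * r / lam ^+ 19 ->
  2^-1 * t `^ (- (2 / 3)) / lam ^+ 17 <= qker E (2 * t) x y.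
Proof.
move=> xB Vy dxy; have hq := qker_diag_lower xB; have [Vx _] := xB.
have rt := r_le_tau; have tp := tau_gt0.
rewrite (_ : 2 * t = t + t); last by ring.
rewrite powR_tau.
have tt0 : 0 < t + t by rewrite addr_gt0.
have hg := qker_gradient Esub Econn mu_gt0 Vx Vy tt0.
set q := qker E (t + t) x x in hq hg *; set q' := qker E (t + t) x y in hg *.
have e0 : 0 < r ^- 2 / lam ^+ 13 by rewrite divr_gt0 ?invr_gt0 ?exprn_gt0.
have q0 : 0 < q by exact: lt_le_trans hq.
have /andP[t6 _] := tI.
(* The exponent is [19 = 13 + 6], from the lower bounds for [q] and for [t]. The squared difference
   is then at most [(q / 2) ^ 2]. *)
have dt : (gdist E x y)%:R / (t + t) <= q / 4.
  rewrite ler_pdivrMr//; apply: (le_trans dxy).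
  apply: (@le_trans _ _ ((r ^- 2 / lam ^+ 13) / 4 * (r ^+ 3 / lam ^+ 6 + r ^+ 3 / lam ^+ 6))).
    rewrite le_eqVlt; apply/orP; left; apply/eqP.
    by field; rewrite !gt_eqF.
  have s0 : 0 <= r ^+ 3 / lam ^+ 6 by rewrite divr_ge0// exprn_ge0// ltW.
  by apply: ler_pM; lra.
have qq : q / 2 <= q'.
  suff : q - q' <= q / 2 by lra.
  rewrite leNgt; apply/negP => h; have : (q / 2) ^+ 2 < (q - q') ^+ 2.
    by apply: ltr_sqr_pos; lra.
  have : (gdist E x y)%:R * (q / (t + t)) <= q * (q / 4).
    by rewrite mulrCA ler_wpM2l// ltW.
  by nra.
apply: le_trans qq. rewrite -mulrA mulrC ler_wpM2r//.
(* By [r <= lam ^ 2 tau], the factor [r ^- 2] is at least [tau ^- 2 / lam ^ 4], and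
   [17 = 13 + 4]. *)
apply: le_trans hq.
rewrite [leRHS](_ : _ = (lam ^+ 4 / r ^+ 2) / lam ^+ 17); last by field; rewrite !gt_eqF.
rewrite ler_wpM2r ?invr_ge0 ?exprn_ge0 ?(ltW lam0)//.
rewrite ler_pdivlMr ?exprn_gt0// mulrC ler_pdivrMr ?exprn_gt0//.
rewrite (_ : lam ^+ 4 * tau ^+ 2 = (lam ^+ 2 * tau) ^+ 2); last by ring.
by rewrite lerXn2r// nnegrE ?(ltW r0)// mulr_ge0 ?exprn_ge0 ?(ltW lam0) ?(ltW tp).
Qed.

(** If [phi > 2 a] with [a = lam ^ 6 / r ^ 2], the gradient estimate keeps the kernel above
    [phi / 2] on [B(x0, r / lam ^ 2)], whose volume is at least [1 / a]; the total mass would exceed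
    1. *)
Lemma qker_diag_upper : qker E (t + t) x0 x0 <= 2 * (lam ^+ 6 / r ^+ 2).
Proof.
have tt0 : 0 < t + t by rewrite addr_gt0.
have l64 := lam_ge64.
set a := lam ^+ 6 / r ^+ 2; set phi := qker _ _ _ _.
have a0 : 0 < a by rewrite divr_gt0 ?exprn_gt0.
pose s := r / lam ^+ 2.
have s0 : 0 < s by rewrite divr_gt0// exprn_gt0.
rewrite leNgt; apply/negP => h.
have phi0 : 0 < phi by lra.
pose S' := bseq E x0 (Num.truncn s).
have sV : {subset S' <= V} by exact: bseq_V.
have hv : a^-1 <= \sum_(y <- S') mu y.
  have [_ _ _ _ +] := hgood; rewrite (vol_bseq Esub Econn) ?(ltW s0)//.
  by rewrite /a invf_div.
have st : s / (t + t) <= a / 4.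
  have /andP[t6 _] := tI.
  rewrite ler_pdivrMr//.
  apply: (@le_trans _ _ (a / 4 * (r ^+ 3 / lam ^+ 6 + r ^+ 3 / lam ^+ 6))); last first.
    by apply: ler_wpM2l; [rewrite divr_ge0// ltW|exact: lerD].
  have -> : a / 4 * (r ^+ 3 / lam ^+ 6 + r ^+ 3 / lam ^+ 6) = r / 2.
    by rewrite /a; field; rewrite !gt_eqF.
  rewrite /s ler_pM2l// lef_pV2 ?posrE ?exprn_gt0//; nra.
have low y : y \in S' -> phi / 2 <= qker E (t + t) x0 y.
  move=> yS; have Vy := sV y yS.
  have := qker_gradient Esub Econn mu_gt0 Vx0 Vy tt0.
  rewrite -/phi; set q' := qker _ _ _ _ => hg.
  have ds : (gdist E x0 y)%:R <= s.
    by move: yS; rewrite /S' (bseq_gdist Esub Econn)// => /andP[_]; rewrite truncn_ge_nat// ltW.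
  suff : phi - q' <= phi / 2 by lra.
  rewrite leNgt; apply/negP => h'; have : (phi / 2) ^+ 2 < (phi - q') ^+ 2.
    by apply: ltr_sqr_pos; lra.
  have : (gdist E x0 y)%:R * (phi / (t + t)) <= phi * (a / 4).
    rewrite mulrCA ler_wpM2l ?(ltW phi0)//; apply: le_trans st.
    by rewrite ler_wpM2r// invr_ge0 ltW.
  by nra.
have := sum_qker_le1 Esub mu_gt0 (bseq_uniq E x0 (Num.truncn s)) sV Vx0 (ltW tt0).
apply/negP; rewrite -ltNge.
apply: (@lt_le_trans _ _ (\sum_(y <- S') mu y * (phi / 2))).
  rewrite -mulr_suml; apply: (@lt_le_trans _ _ (a^-1 * (phi / 2))).
    by rewrite mulrC ltr_pdivlMr// mul1r; lra.
  by rewrite ler_wpM2r// divr_ge0// ltW.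
rewrite big_seq [leRHS]big_seq; apply: ler_sum => y yS.
by rewrite ler_wpM2l ?mu_ge0// low.
Qed.

Lemma qker_upper (K : R) y : 0 <= K -> gball V E x0 (K * tau) y ->
  qker E (2 * t) x0 y <= (1 + Num.sqrt K) * t `^ (- (2 / 3)) * lam ^+ 3.
Proof.
move=> K0 [Vy dy]; have tp := tau_gt0; have l64 := lam_ge64.
rewrite (_ : 2 * t = t + t); last by ring.
rewrite powR_tau.
have tt0 : 0 < t + t by rewrite addr_gt0.
have hg := qker_gradient Esub Econn mu_gt0 Vx0 Vy tt0.
have hd := qker_diag_upper.
set q := qker E (t + t) x0 x0 in hd hg *; set q' := qker E (t + t) x0 y in hg *.
set a := lam ^+ 6 / r ^+ 2 in hd.
have a0 : 0 < a by rewrite divr_gt0 ?exprn_gt0.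
pose b := lam ^+ 3 / tau ^+ 2.
have b0 : 0 < b by rewrite divr_gt0 ?exprn_gt0.
(* Cubing removes the cube root: [64 a ^ 3 t ^ 2 <= 64 lam ^ 8 <= lam ^ 9], the last step by
   [lam >= 64]. *)
have ab : 4 * a <= b.
  rewrite /b ler_pdivlMr ?exprn_gt0//.
  have p0 : 0 <= 4 * a * tau ^+ 2 by apply: mulr_ge0; [lra|rewrite exprn_ge0// ltW].
  rewrite -(@ler_pXn2r _ 3)// ?nnegrE ?exprn_ge0 ?(ltW lam0)//.
  have /andP[_ t5] := tI.
  apply: (@le_trans _ _ (64 * a ^+ 3 * (r ^+ 3 / lam ^+ 5) ^+ 2)).
    rewrite [leLHS](_ : _ = 64 * a ^+ 3 * t ^+ 2); last by rewrite -tau3; ring.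
    apply: ler_wpM2l; first by apply: mulr_ge0 => //; rewrite exprn_ge0// ltW.
    by rewrite lerXn2r// nnegrE ?(ltW t0)// (le_trans (ltW t0)).
  have -> : 64 * a ^+ 3 * (r ^+ 3 / lam ^+ 5) ^+ 2 = 64 * lam ^+ 8.
    by rewrite /a; field; rewrite !gt_eqF.
  rewrite -exprM (_ : (3 * 3 = 1 + 8)%N)// exprD expr1.
  by apply: ler_wpM2r; [rewrite exprn_ge0// ltW|exact: l64].
have q0 : 0 <= q by apply: (qker_ge0 Esub mu_gt0) => //; exact: ltW.
have qb : q <= b / 2 by lra.
(* With [d(x0, y) <= K tau] and [q <= b / 2], the gradient estimate gives at most
   [K b / (4 tau ^ 2)], and [tau ^- 2 <= b] because [lam >= 1]. *)
have h1 : (q - q') ^+ 2 <= (Num.sqrt K * b) ^+ 2.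
  apply: (le_trans hg); rewrite exprMn sqr_sqrtr//.
  apply: (@le_trans _ _ (K * tau * (b / 2 / (t + t)))).
    apply: ler_pM => //; first by rewrite divr_ge0// ltW.
    by rewrite ler_wpM2r// invr_ge0 ltW.
  rewrite -mulrA ler_wpM2l//.
  have -> : tau * (b / 2 / (t + t)) = b * (4^-1 * tau ^- 2).
    by rewrite -tau3; field; rewrite gt_eqF// lt0r_neq0// -mulr2n pmulrn_lgt0// exprn_gt0.
  rewrite [b ^+ 2]expr2 ler_wpM2l ?(ltW b0)// /b; apply: ler_wpM2r.
    by rewrite invr_ge0 exprn_ge0// ltW.
  by apply: (@le_trans _ _ 1); [lra|exact: exprn_ege1].
have sb0 : 0 <= Num.sqrt K * b by rewrite mulr_ge0 ?sqrtr_ge0 ?(ltW b0).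
have h2 : q' - q <= Num.sqrt K * b.
  rewrite leNgt; apply/negP => h; have : (Num.sqrt K * b) ^+ 2 < (q' - q) ^+ 2.
    by apply: ltr_sqr_pos; lra.
  by move: h1; rewrite -sqrrN opprB => /le_lt_trans /[apply]; rewrite ltxx.
have -> : (1 + Num.sqrt K) * tau ^- 2 * lam ^+ 3 = b + Num.sqrt K * b.
  by rewrite /b; ring.
by lra.
Qed.

End Time.
End GoodBall.

Theorem theorem4p7 (R : realType) (n0 : nat) (hn0 : (2 <= n0)%N)
  (V : pred (word n0)) (E : rel (word n0))
  (hsub : subgraph_of_B V E) (hconn : connected_graph V E)
  (hinf : infinite_graph V) :
  exists c0 c1 c2 : R, [/\ 0 < c0, 0 < c1, 0 < c2 &
    forall (x0 : word n0) (r lam : R),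
      V x0 -> 1 <= r -> 1 <= lam -> good V E x0 r lam ->
      let B := gball V E x0 r in
      let I := [set t : R | r ^+ 3 / lam ^+ 6 <= t <= r ^+ 3 / lam ^+ 5] in
      [/\ (* (a) *)
          (forall x, gball V E x0 (r / lam) x ->
             ((c0 * r ^+ 3 / lam ^+ 5)%:E <= Etau R E B x)%E /\
             (Etau R E B x <= (2 * lam * r ^+ 3)%:E)%E),
          (* (b) *)
          (forall K : R, 0 <= K -> forall t y, I t ->
             gball V E x0 (K * t `^ (3^-1)) y ->
             qker E (2 * t) x0 y <= (1 + Num.sqrt K) * t `^ (- (2 / 3)) * lam ^+ 3) &
          (* (c) *)
          (forall x y t, gball V E x0 (r / lam) x -> V y ->
             (gdist E x y)%:R <= c2 * r / lam ^+ 19 -> I t ->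
             c1 * t `^ (- (2 / 3)) / lam ^+ 17 <= qker E (2 * t) x y)]].
Proof.
exists 6, 2^-1, 2^-1; split; rewrite ?invr_gt0// => x0 r lam Vx0 r1 lam1 hgood B I.
split.
- by move=> x; exact: Etau_bounds.
- by move=> K K0 t y tI; exact: (qker_upper hsub hconn hinf Vx0 r1 lam1 hgood).
- by move=> x y t xB Vy dxy tI; exact: (qker_lower hsub hconn hinf Vx0 r1 lam1 hgood).
Qed.
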